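(* For every positive integer $k$, let $R(k):=\#\{A\in\mathbb{A}\cap(0,e^{-e}) : h_o(A)\text{ and }h_e(A)\text{ are algebraic and }\mathrm{ord}(A)=k\}$. Then $R(k)=1$ if there exists $v\in\mathbb{N}$ with $k=v^v$, and $R(k)=0$ otherwise.
   Context: $\mathbb{A}$ denotes the set of algebraic numbers. For $x\in(0,e^{-e})$, the sequences $x,\ x^{x^x},\ x^{x^{x^{x^x}}},\ldots$ (towers of odd height) and $x^x,\ x^{x^{x^x}},\ldots$ (towers of even height) converge; their limits are denoted $h_o(x)$ and $h_e(x)$ respectively, and they satisfy $h_o(x)=x^{h_e(x)}$, $h_e(x)=x^{h_o(x)}$, $0<h_o(x)<1/e<h_e(x)<1$. For an algebraic number $A$, $\mathrm{ord}(A):=\min\{n\in\mathbb{N}: A^n\in\mathbb{Q}\}$ if such $n$ exists, and $\infty$ otherwise. *)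

(* Defs.v *)
From Stdlib Require Import Reals ZArith List.
Open Scope R_scope.

Fixpoint zpoly_eval (l : list Z) (x : R) : R :=
  match l with
  | nil => 0
  | c :: l' => IZR c + x * zpoly_eval l' x
  end.

Definition algebraic (x : R) : Prop :=
  exists l : list Z, (exists c, In c l /\ c <> 0%Z) /\ zpoly_eval l x = 0.

Definition is_rational (x : R) : Prop :=
  exists p q : Z, q <> 0%Z /\ x = IZR p / IZR q.

Fixpoint tower (x : R) (n : nat) : R :=
  match n with
  | O => 1
  | S m => Rpower x (tower x m)
  end.

Definition is_h_o (x l : R) : Prop := Un_cv (fun n => tower x (2 * n + 1)) l.
Definition is_h_e (x l : R) : Prop := Un_cv (fun n => tower x (2 * n + 2)) l.

Definition ord_eq (A : R) (k : nat) : Prop :=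
  (1 <= k)%nat /\ is_rational (A ^ k) /\
  forall n : nat, (1 <= n)%nat -> (n < k)%nat -> ~ is_rational (A ^ n).

Definition counted (k : nat) (A : R) : Prop :=
  algebraic A /\ 0 < A < exp (- exp 1) /\
  (exists ho he, is_h_o A ho /\ is_h_e A he /\ algebraic ho /\ algebraic he) /\
  ord_eq A k.

(* Main.v *)
Require Import Defs.
From Stdlib Require Import Reals ZArith List Lra Lia.
Open Scope R_scope.

(* Put [a = h_o(A)] and [b = h_e(A)], so that [A^a = b] and [A^b = a]. If [A], [a] and [b]
   are algebraic, the Gelfond-Schneider theorem makes [a] and [b] rational. Say [a < b] and
   [a / b = p / q] in lowest terms; then [b^(q-p) = (p/q)^p], so [p] and [q] are [(q-p)]-th
   powers which differ by [q-p], and this forces [q = p + 1]. With [v = p] one gets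
   [A = (v/(v+1))^((v+1)^(v+1)/v^v)], whose order is [v^v] since [v/(v+1)] is not a proper
   power. Conversely, odd towers increase to the least fixed point of [x |-> A^(A^x)]; this
   map has at most three fixed points, because its slope is [t z e^(-z)] with [t = - ln A]
   and [z = t A^x], and [z e^(-z)] takes no value three times. The same slope computation
   gives [A < e^(-e)] as soon as there are three fixed points.

   Only the real case of Gelfond-Schneider is needed, and there real analysis suffices.
   Assume [beta] irrational and [alpha], [beta], [alpha^beta] algebraic, and consider the
   determinant of the functions [x^u alpha^(t x)] ([u < n^3], [t < n]) at the points
   [a + b beta] ([a, b < n^2]). By Rolle's theorem a real exponential polynomial has fewer
   zeros than terms, so the determinant is nonzero. The mean value theorem for divided
   differences makes it very small, about [n^(-n^8/2)]. But an integer multiple of it, of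
   controlled size, is an eigenvalue of an integer matrix with controlled entries, and the
   lowest nonzero coefficient of the characteristic polynomial bounds a nonzero eigenvalue
   from below by [n^(-C n^7)]: a contradiction for large [n]. *)

(** * Limits of towers *)

Section Towers.

Variable A : R.
Hypothesis A_pos : 0 < A.
Hypothesis A_lt1 : A < 1.

Let F x := Rpower A x.
Let g x := F (F x).
Let t := - ln A.

Lemma neg_ln_pos : 0 < t.
Proof. unfold t. assert (ln A < ln 1) by (apply ln_increasing; lra). rewrite ln_1 in H. lra. Qed.

Lemma power_decreasing x y : x < y -> F y < F x.
Proof.
  intro H. apply exp_increasing. pose proof neg_ln_pos as T. unfold t in T. nra.
Qed.

Lemma power_twice_increasing x y : x < y -> g x < g y.
Proof. intro H. now apply power_decreasing, power_decreasing. Qed.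

Lemma power_pos x : 0 < F x.
Proof. apply exp_pos. Qed.

Lemma derivable_power x : derivable_pt_lim F x (- t * F x).
Proof.
  unfold F, Rpower, t.
  replace (- - ln A * exp (x * ln A)) with (exp (x * ln A) * (1 * ln A + x * 0)) by ring.
  apply (derivable_pt_lim_comp (fun x => x * ln A) exp).
  - apply (derivable_pt_lim_mult id (fun _ => ln A)).
    apply derivable_pt_lim_id. apply derivable_pt_lim_const.
  - apply derivable_pt_lim_exp.
Qed.

Lemma power_continuous x : continuity_pt F x.
Proof. apply derivable_continuous_pt. exists (- t * F x). apply derivable_power. Qed.

Let k z := z * exp (- z).

Lemma derivable_power_twice x : derivable_pt_lim g x (t * k (t * F x)).
Proof.
  replace (t * k (t * F x)) with ((- t * F (F x)) * (- t * F x)).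
  - apply (derivable_pt_lim_comp F F); apply derivable_power.
  - unfold k. replace (F (F x)) with (exp (- (t * F x))); [ring|].
    unfold F at 2, Rpower, t. f_equal. ring.
Qed.

Lemma fixed_points_slope x y : x < y -> g x = x -> g y = y ->
  exists z, x < z < y /\ t * k (t * F z) = 1.
Proof.
  intros xy gx gy.
  destruct (MVT_cor2 g (fun z => t * k (t * F z)) x y xy) as [z [E Z]].
  - intros c _. apply derivable_power_twice.
  - exists z. split; [exact Z|]. rewrite gx, gy in E. apply Rmult_eq_reg_r with (y - x); lra.
Qed.

Lemma slope_decreasing x y : x < y -> t * F y < t * F x.
Proof. intro H. apply Rmult_lt_compat_l; [apply neg_ln_pos | now apply power_decreasing]. Qed.

(** By the mean value theorem [k'] vanishes between [x] and [y], and [k'(c) = (1 - c) exp(-c)] has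
    [1] as its only zero. *)
Lemma k_critical x y : x < y -> k x = k y -> x < 1 < y.
Proof.
  intros xy E.
  assert (D : forall c, derivable_pt_lim k c ((1 - c) * exp (- c))).
  { intro c. unfold k.
    replace ((1 - c) * exp (- c)) with (1 * exp (- c) + c * (exp (- c) * - 1)) by ring.
    apply (derivable_pt_lim_mult id (fun z => exp (- z))).
    - apply derivable_pt_lim_id.
    - apply (derivable_pt_lim_comp (fun z => - z) exp).
      apply (derivable_pt_lim_opp id), derivable_pt_lim_id. apply derivable_pt_lim_exp. }
  destruct (MVT_cor2 k _ x y xy (fun c _ => D c)) as [z [Ez Z]].
  assert (W : 0 < exp (- z) * (y - x)) by (apply Rmult_lt_0_compat; [apply exp_pos|lra]).
  assert (z = 1) by nra. lra.
Qed.

(** Four fixed points give three decreasing arguments at which [k] equals [1 / t]; by [k_critical]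
    the middle one would be both below and above [1]. *)
Lemma no_four_fixed_points x1 x2 x3 x4 : x1 < x2 -> x2 < x3 -> x3 < x4 ->
  g x1 = x1 -> g x2 = x2 -> g x3 = x3 -> g x4 = x4 -> False.
Proof.
  intros h1 h2 h3 e1 e2 e3 e4.
  destruct (fixed_points_slope x1 x2 h1 e1 e2) as [z1 [Z1 E1]].
  destruct (fixed_points_slope x2 x3 h2 e2 e3) as [z2 [Z2 E2]].
  destruct (fixed_points_slope x3 x4 h3 e3 e4) as [z3 [Z3 E3]].
  pose proof neg_ln_pos as T.
  assert (S1 : t * F z2 < t * F z1) by (apply slope_decreasing; lra).
  assert (S2 : t * F z3 < t * F z2) by (apply slope_decreasing; lra).
  assert (K1 : k (t * F z2) = k (t * F z1)) by (apply Rmult_eq_reg_l with t; lra).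
  assert (K2 : k (t * F z3) = k (t * F z2)) by (apply Rmult_eq_reg_l with t; lra).
  pose proof (k_critical _ _ S1 K1). pose proof (k_critical _ _ S2 K2). lra.
Qed.

Lemma k_max z : z <> 1 -> k z < / exp 1.
Proof.
  intro H. unfold k.
  replace (/ exp 1) with (exp (z - 1) * exp (- z))
    by (rewrite <- exp_plus, <- exp_Ropp; f_equal; ring).
  apply Rmult_lt_compat_r; [apply exp_pos|].
  pose proof (exp_ineq1 (z - 1)). lra.
Qed.

(** Of two distinct solutions of [t * k z = 1] at least one differs from [1]; there [k z < 1 / e],
    so [t > e]. *)
Lemma three_fixed_points x1 x2 x3 : x1 < x2 -> x2 < x3 ->
  g x1 = x1 -> g x2 = x2 -> g x3 = x3 -> A < exp (- exp 1).
Proof.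
  intros h1 h2 e1 e2 e3.
  destruct (fixed_points_slope x1 x2 h1 e1 e2) as [z1 [Z1 E1]].
  destruct (fixed_points_slope x2 x3 h2 e2 e3) as [z2 [Z2 E2]].
  pose proof neg_ln_pos as T.
  assert (S : t * F z2 < t * F z1) by (apply slope_decreasing; lra).
  assert (Te : exp 1 < t).
  { assert (X : exists z, z <> 1 /\ t * k z = 1).
    { destruct (Req_dec (t * F z1) 1) as [W|W].
      - exists (t * F z2). split; [lra|exact E2].
      - exists (t * F z1). split; [exact W|exact E1]. }
    destruct X as [z [W E]]. pose proof (k_max z W) as M.
    pose proof (exp_pos 1) as P.
    apply Rmult_lt_reg_r with (/ exp 1); [now apply Rinv_0_lt_compat|].
    rewrite Rinv_r by lra. apply Rle_lt_trans with (t * k z); [lra|]. now apply Rmult_lt_compat_l. }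
  rewrite <- (exp_ln A A_pos). apply exp_increasing. unfold t in Te. lra.
Qed.

Let odd n := tower A (2 * n + 1).

Lemma odd_S n : odd (S n) = g (odd n).
Proof.
  unfold odd. replace (2 * S n + 1)%nat with (S (S (2 * n + 1))) by lia. reflexivity.
Qed.

(** Since [A ^ 0 = 1], the odd towers are the orbit of [0] under the increasing map [g]; this starts
    the inductions below. *)
Lemma odd_0 : odd 0 = g 0.
Proof. unfold odd, g, F. cbn. now rewrite (Rpower_O A A_pos). Qed.

Lemma odd_pos n : 0 < odd n.
Proof. destruct n; [rewrite odd_0 | rewrite odd_S]; apply power_pos. Qed.

Lemma odd_growing : Un_growing odd.
Proof.
  intro n. apply Rlt_le. induction n as [|n IH].
  - rewrite odd_S, odd_0. apply power_twice_increasing, power_pos.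
  - rewrite (odd_S (S n)), (odd_S n) at 1. now apply power_twice_increasing.
Qed.

Lemma odd_below_fixed x n : 0 < x -> g x = x -> odd n < x.
Proof.
  intros x0 gx. induction n as [|n IH].
  - rewrite odd_0, <- gx. now apply power_twice_increasing.
  - rewrite odd_S, <- gx. now apply power_twice_increasing.
Qed.

Lemma even_limit l : Un_cv odd l -> Un_cv (fun n => tower A (2 * n + 2)) (F l).
Proof.
  intro H. apply (continuity_seq F odd l) in H; [|apply power_continuous].
  intros eps He. destruct (H eps He) as [N HN]. exists N. intros n Hn.
  replace (tower A (2 * n + 2)) with (F (odd n)); [now apply HN|].
  unfold odd. now replace (2 * n + 2)%nat with (S (2 * n + 1)) by lia.
Qed.

Lemma odd_limit_fixed l : Un_cv odd l -> g l = l /\ 0 < l.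
Proof.
  intro H. split.
  - apply (UL_sequence (fun n => odd (S n))).
    + pose proof (even_limit l H) as E.
      apply (continuity_seq F _ (F l)) in E; [|apply power_continuous].
      intros eps He. destruct (E eps He) as [N HN]. exists N. intros n Hn.
      replace (odd (S n)) with (F (tower A (2 * n + 2))); [now apply HN|].
      unfold odd. now replace (2 * S n + 1)%nat with (S (2 * n + 2)) by lia.
    + intros eps He. destruct (H eps He) as [N HN]. exists N. intros n Hn. apply HN. lia.
  - apply Rlt_le_trans with (odd 0); [apply odd_pos|].
    exact (growing_ineq odd l odd_growing H 0).
Qed.

Lemma tower_limits a b : 0 < a -> a < b -> Rpower A a = b -> Rpower A b = a ->
  A < exp (- exp 1) /\ is_h_o A a /\ is_h_e A b.
Proof.
  intros a0 ab Ea Eb. change (F a = b) in Ea. change (F b = a) in Eb.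
  assert (ga : g a = a) by (unfold g; now rewrite Ea).
  assert (gb : g b = b) by (unfold g; now rewrite Eb).
  split.
  (* [x - F x] changes sign between [a] and [b], which yields a third fixed point. *)
  - destruct (IVT (fun x => x - F x) a b) as [c [C Ec]].
    + intro x. apply (continuity_pt_minus id F).
      apply derivable_continuous_pt, derivable_pt_id. apply power_continuous.
    + exact ab.
    + lra.
    + lra.
    + assert (Fc : F c = c) by lra.
      assert (c <> a) by (intros ->; lra). assert (c <> b) by (intros ->; lra).
      apply (three_fixed_points a c b); try lra.
      unfold g. now rewrite !Fc.
  - destruct (growing_cv odd odd_growing) as [l Hl].
    + exists a. intros x [n ->]. apply Rlt_le. now apply odd_below_fixed.
    + destruct (odd_limit_fixed l Hl) as [gl l0].
      assert (la : l = a).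
      { destruct (Rtotal_order l a) as [H|[H|H]]; [exfalso|exact H|exfalso].
        (* A limit [l] below [a] would make [l < a < b < F l] four fixed points of [g]. *)
        - apply (no_four_fixed_points l a b (F l)); trivial.
          + rewrite <- Ea. now apply power_decreasing.
          + unfold g. f_equal. exact gl.
        - assert (Q : 0 < l - a) by lra. destruct (Hl _ Q) as [N HN].
          specialize (HN N (le_n N)). unfold Rdist in HN. apply Rabs_def2 in HN.
          pose proof (odd_below_fixed a N a0 ga). lra. }
      subst l. split; [exact Hl|]. unfold is_h_e. rewrite <- Ea. now apply even_limit.
Qed.

Lemma tower_limits_inv ho he : A < exp (- exp 1) -> is_h_o A ho -> is_h_e A he ->
  0 < ho /\ 0 < he /\ ho <> he /\ Rpower A ho = he /\ Rpower A he = ho.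
Proof.
  intros Ae Ho He. change (Un_cv odd ho) in Ho.
  destruct (odd_limit_fixed ho Ho) as [go ho0].
  assert (E : F ho = he) by exact (UL_sequence _ _ _ (even_limit ho Ho) He).
  assert (E' : F he = ho) by (rewrite <- E; exact go).
  repeat split; trivial.
  - rewrite <- E. apply power_pos.
  - intro H. rewrite <- H in E. pose proof neg_ln_pos as T.
    assert (te : exp 1 < t).
    { unfold t. apply ln_increasing in Ae; [|exact A_pos]. rewrite ln_exp in Ae. lra. }
    assert (hE : exp (- (t * ho)) = ho).
    { rewrite <- E at 2. unfold F, Rpower, t. f_equal. ring. }
    (* The fixed point of [F] is repelling, while the increasing sequence of odd
       towers would have to converge to it. *)
    assert (slope : 1 < t * k (t * F ho)).
    (* At a fixed point of [F] the slope is [(t * ho) ^ 2]. If [t * ho <= 1], then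
       [ho = exp (- (t * ho)) >= 1 / e], so [t * ho > e / e = 1] after all. *)
    { rewrite E. unfold k. rewrite hE.
      assert (1 < t * ho); [|nra].
      destruct (Rlt_le_dec 1 (t * ho)) as [X|X]; [exact X|exfalso].
      assert (Y : / exp 1 <= ho).
      { rewrite <- hE, <- exp_Ropp. destruct X as [X|X]; [left; apply exp_increasing; lra|].
        right. now rewrite X. }
      pose proof (exp_pos 1) as P.
      assert (exp 1 * / exp 1 < t * ho); [|rewrite Rinv_r in H0 by lra; lra].
      apply Rlt_le_trans with (t * / exp 1).
      - apply Rmult_lt_compat_r; [now apply Rinv_0_lt_compat|exact te].
      - apply Rmult_le_compat_l; lra. }
    set (m := t * k (t * F ho)) in *.
    (* With tolerance [m - 1] the difference quotient at [odd N] exceeds [1], so [odd (S N)] is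
       farther below [ho] than [odd N], although the sequence grows. *)
    destruct (derivable_power_twice ho (m - 1)) as [d Hd]; [lra|].
    destruct (Ho d (cond_pos d)) as [N HN]. specialize (HN N (le_n N)).
    pose proof (odd_below_fixed ho N ho0 go) as B.
    assert (nz : odd N - ho <> 0) by lra.
    specialize (Hd _ nz HN). replace (ho + (odd N - ho)) with (odd N) in Hd by ring.
    rewrite go, <- odd_S in Hd. apply Rabs_def2 in Hd. fold m in Hd.
    assert (R1 : 1 < (odd (S N) - ho) / (odd N - ho)) by lra.
    pose proof (odd_growing N) as G.
    assert ((odd (S N) - ho) / (odd N - ho) * (odd N - ho) = odd (S N) - ho) by (field; exact nz).
    nra.
Qed.
End Towers.

(* In a module, so that MathComp's [<=] on [nat] does not capture the one of the theorem. *)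
Module TowerLimits.

From mathcomp Require Import all_boot all_order fingroup perm all_algebra.
From mathcomp Require Import lra ring zify Rstruct.
Set Implicit Arguments.
Unset Strict Implicit.
Unset Printing Implicit Defensive.
Import Order.TTheory GRing.Theory Num.Theory.
Local Open Scope ring_scope.
(* Otherwise arguments of type [R] would be parsed in Stdlib's [R_scope]. *)
Bind Scope ring_scope with R.
Local Arguments exp : clear scopes.
Local Arguments derivable_pt_lim : clear scopes.
Local Arguments ln : clear scopes.
Local Arguments Rpower : clear scopes.

(** * Lower bounds for algebraic numbers *)

Section Majorant.
Variable F : realFieldType.

Definition majorant (p q : {poly F}) := forall i, `|p`_i| <= q`_i.

Lemma majorant0 : majorant 0 0.
Proof. by move=> i; rewrite coef0 normr0. Qed.

Lemma majorantD p q p' q' :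
  majorant p q -> majorant p' q' -> majorant (p + p') (q + q').
Proof.
move=> h h' i; rewrite !coefD.
exact: le_trans (ler_normD _ _) (lerD (h i) (h' i)).
Qed.

Lemma majorantM p q p' q' :
  majorant p q -> majorant p' q' -> majorant (p * p') (q * q').
Proof.
move=> h h' i; rewrite !coefM.
apply: le_trans (ler_norm_sum _ _ _) (ler_sum _ _) => j _.
by rewrite normrM ler_pM.
Qed.

Lemma majorant_prod (I : Type) (s : seq I) (P Q : I -> {poly F}) :
  (forall i, majorant (P i) (Q i)) ->
  majorant (\prod_(i <- s) P i) (\prod_(i <- s) Q i).
Proof.
move=> h; apply: (big_ind2 majorant) => //; last exact: majorantM.
by move=> i; rewrite coef1; case: eqP; rewrite ?normr1 ?normr0.
Qed.

Lemma majorant_sum (I : Type) (s : seq I) (P Q : I -> {poly F}) :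
  (forall i, majorant (P i) (Q i)) ->
  majorant (\sum_(i <- s) P i) (\sum_(i <- s) Q i).
Proof.
by move=> h; apply: (big_ind2 majorant) => //; [exact: majorant0|exact: majorantD].
Qed.

(** In the Leibniz expansion each of the [n!] terms is a sign times [n] entries of [X - B], each
    majorised by [X + h]. *)
Lemma char_poly_majorant n (B : 'M[F]_n) (h : F) :
  0 <= h -> (forall i j, `|B i j| <= h) ->
  majorant (char_poly B) (('X + h%:P) ^+ n *+ n`!).
Proof.
move=> h0 hB; rewrite /char_poly /determinant.
have -> : ('X + h%:P) ^+ n *+ n`! = \sum_(s : 'S_n) ('X + h%:P) ^+ n.
  by rewrite sumr_const -card_Sn.
apply: majorant_sum => s; rewrite -[('X + _) ^+ n]mul1r.
apply: majorantM.
  move=> i; rewrite -polyC1.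
  have -> : (-1) ^+ s = ((-1) ^+ s)%:P :> {poly F} by rewrite rmorphXn rmorphN1.
  by rewrite !coefC; case: ifP; rewrite ?normr0 // normrX normrN1 expr1n.
have -> : ('X + h%:P) ^+ n = \prod_(i < n) ('X + h%:P).
  by rewrite prodr_const card_ord.
apply: majorant_prod => i k; rewrite !mxE coefB coefD coefMn coefX !coefC.
apply: le_trans (ler_normB _ _) _.
apply: lerD; first by case: (i == _); case: (k == 1%N); rewrite /= ?mulr1n ?mulr0n ?normr1 ?normr0.
by case: ifP => // _; rewrite ?normr0.
Qed.

Lemma majorant_sum_coef (p q : {poly F}) m :
  majorant p q -> \sum_(i < m) `|p`_i| <= q.[1].
Proof.
move=> h; have q0 i : 0 <= q`_i by apply: le_trans (h i).
rewrite horner_coef.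
apply: le_trans (_ : _ <= \sum_(i < m) q`_i) _; first by apply: ler_sum.
under [leRHS]eq_bigr do rewrite expr1n mulr1.
rewrite -!(big_mkord xpredT (fun i => q`_i)).
case: (leqP m (size q)) => hm.
  by rewrite (big_cat_nat (leq0n _) hm) //= lerDl sumr_ge0.
rewrite (big_cat_nat (leq0n _) (ltnW hm)) //= [X in _ + X]big_nat [X in _ + X]big1 ?addr0 //.
by move=> i /andP[hi _]; rewrite nth_default.
Qed.

(** With [p_k] the lowest nonzero coefficient, dividing by [x ^ k] gives [p_k = - x r(x)], and the
    integer [p_k] is at least [1] in absolute value. If [|x| < 1] then [|r(x)| <= C]; otherwise
    [C >= 1] suffices. *)
Lemma int_poly_root_lower_bound (p : {poly int}) (x C : F) :
  p != 0 -> x != 0 -> root (map_poly intr p) x ->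
  (forall m, \sum_(i < m) `|(map_poly intr p : {poly F})`_i| <= C) ->
  1 <= `|x| * C.
Proof.
move=> p0 x0 rx hC.
have [k pk kmin] : exists2 k, p`_k != 0 & forall j, (j < k)%N -> p`_j = 0.
  have ex : exists k, p`_k != 0 by exists (size p).-1; rewrite -lead_coefE lead_coef_eq0.
  case: (ex_minnP ex) => k pk kmin; exists k => // j jk.
  by apply/eqP; apply: contraTT jk => /kmin; rewrite -leqNgt.
have hp1 : 1 <= `|(map_poly intr p : {poly F})`_k|.
  rewrite coef_map /= -intr_norm -[1]/(1%:~R) ler_int.
  by move: pk; rewrite -normr_gt0; case: (`|_|) => [[]|].
have hC1 : 1 <= C.
  apply: le_trans hp1 (le_trans _ (hC k.+1)).
  by rewrite big_ord_recr /= lerDr sumr_ge0.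
case: (lerP 1 `|x|) => hx; first by rewrite -[1]mulr1 ler_pM.
move: rx; set P := map_poly _ _ in hp1 hC * => rx.
have tk0 : take_poly k P = 0.
  by apply/polyP => i; rewrite coef_take_poly coef0 coef_map; case: ifP => // /kmin ->.
pose q := drop_poly k P; pose r := drop_poly k.+1 P.
have Pq : P = q * 'X^k by rewrite -[LHS](poly_take_drop k) tk0 add0r.
have qr : q = (P`_k)%:P + r * 'X.
  apply/polyP => i; rewrite coefD coefC coefMX !coef_drop_poly.
  by case: i => [|i] /=; rewrite ?addr0 // add0r addnS.
have : q.[x] = 0.
  move: rx; rewrite /root Pq hornerM hornerXn mulf_eq0 => /orP[/eqP//|].
  by rewrite expf_eq0 (negbTE x0) andbF.
rewrite qr !hornerE => /eqP; rewrite addr_eq0 => /eqP Pk.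
apply: le_trans hp1 _; rewrite Pk normrN normrM mulrC.
apply: ler_wpM2l => //; apply: le_trans (hC (k.+1 + size r)%N).
rewrite horner_coef; apply: le_trans (ler_norm_sum _ _ _) _.
rewrite -(big_mkord xpredT (fun i => `|P`_i|)) (big_cat_nat (leq0n _) (leq_addr _ _)) //=.
have -> : \sum_(k.+1 <= i < k.+1 + size r) `|P`_i| = \sum_(i < size r) `|P`_(i + k.+1)|.
  by rewrite -{1}[k.+1]add0n big_addn addKn big_mkord.
apply: ler_wpDl; first by rewrite sumr_ge0.
apply: ler_sum => i _; rewrite normrM normrX coef_drop_poly.
by rewrite ler_piMr // exprn_ile1 // ltW.
Qed.
End Majorant.

(** * Eigenvalues of integer matrices *)

Section Acts.
Variable F : realFieldType.

(* [d] is an eigenvalue of an integer matrix with row sums at most [h]; fixing the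
   eigenvector [w] makes such [d] stable under sums and products, and [h] plays the part of
   the house of an algebraic integer. *)
Definition acts (I : finType) (w : I -> F) (d h : F) :=
  exists2 B : I -> I -> int,
    forall i, d * w i = \sum_j (B i j)%:~R * w j &
    forall i, \sum_j `|(B i j)%:~R : F| <= h.

Lemma acts_weaken (I : finType) (w : I -> F) d h h' : h <= h' -> acts w d h -> acts w d h'.
Proof. by move=> hh [B Bw Bh]; exists B => // i; apply: le_trans (Bh i) hh. Qed.

Lemma acts_int (I : finType) (w : I -> F) (m : int) : acts w m%:~R `|m%:~R|.
Proof.
exists (fun i j => if j == i then m else 0) => i.
  by rewrite (bigD1 i) //= eqxx big1 ?addr0 // => j /negbTE ->; rewrite mul0r.
by rewrite (bigD1 i) //= eqxx big1 ?addr0 // => j /negbTE ->; rewrite normr0.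
Qed.

Lemma actsD (I : finType) (w : I -> F) d h d' h' :
  acts w d h -> acts w d' h' -> acts w (d + d') (h + h').
Proof.
move=> [B Bw Bh] [B' Bw' Bh']; exists (fun i j => B i j + B' i j) => i.
  by rewrite mulrDl Bw Bw' -big_split; apply: eq_bigr => j _; rewrite rmorphD mulrDl.
apply: le_trans (lerD (Bh i) (Bh' i)); rewrite -big_split; apply: ler_sum => j _.
by rewrite rmorphD ler_normD.
Qed.

Lemma actsM (I : finType) (w : I -> F) d h d' h' : 0 <= h' ->
  acts w d h -> acts w d' h' -> acts w (d * d') (h * h').
Proof.
move=> h'0 [B Bw Bh] [B' Bw' Bh']; exists (fun i k => \sum_j B i j * B' j k) => i.
  rewrite mulrAC Bw mulr_suml.
  under eq_bigr => j _ do rewrite -mulrA [_ * d']mulrC Bw' mulr_sumr.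
  rewrite exchange_big; apply: eq_bigr => k _; rewrite rmorph_sum mulr_suml.
  by apply: eq_bigr => j _; rewrite rmorphM mulrA.
apply: le_trans (ler_wpM2r h'0 (Bh i)); rewrite mulr_suml.
apply: le_trans (_ : _ <= \sum_k \sum_j `|(B i j)%:~R| * `|(B' j k)%:~R : F|) _.
  apply: ler_sum => k _; rewrite rmorph_sum; apply: le_trans (ler_norm_sum _ _ _) _.
  by apply: ler_sum => j _; rewrite rmorphM normrM.
rewrite exchange_big; apply: ler_sum => j _; rewrite -mulr_sumr.
exact: ler_wpM2l.
Qed.

Lemma acts_prod (I : finType) (w : I -> F) n (d : 'I_n -> F) h : 0 <= h ->
  (forall k, acts w (d k) h) -> acts w (\prod_k d k) (h ^+ n).
Proof.
move=> h0; elim: n d => [|n IH] d hd.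
  by rewrite big_ord0 expr0; have := acts_int w 1; rewrite normr1.
rewrite big_ord_recr exprSr; apply: actsM => //; exact: IH.
Qed.

Lemma actsX (I : finType) (w : I -> F) n d h : 0 <= h -> acts w d h -> acts w (d ^+ n) (h ^+ n).
Proof. by move=> h0 hd; have := acts_prod (n := n) h0 (fun=> hd); rewrite prodr_const card_ord. Qed.

Lemma acts_sum (I : finType) (w : I -> F) (J : finType) (d : J -> F) h :
  (forall k, acts w (d k) h) -> acts w (\sum_k d k) (h *+ #|J|).
Proof.
move=> hd; rewrite -sumr_const; apply: (big_ind2 (acts w)) => //; last first.
  by move=> *; exact: actsD.
by have := acts_int w 0; rewrite normr0.
Qed.

Lemma acts_det (I : finType) (w : I -> F) n (A : 'M[F]_n) h : 0 <= h ->
  (forall i j, acts w (A i j) h) -> acts w (\det A) (h ^+ n *+ n`!).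
Proof.
move=> h0 hA; rewrite -card_Sn; apply: acts_sum => s.
rewrite -[h ^+ n]mul1r; apply: actsM; [exact: exprn_ge0| |exact: acts_prod].
have := acts_int w ((-1) ^+ s).
by rewrite rmorphXn rmorphN1 normrX normrN1 expr1n.
Qed.

(** [d] is a nonzero root of an integer characteristic polynomial; its majorant, evaluated at [1],
    bounds the sum of the absolute values of the coefficients. *)
Lemma acts_lower_bound (I : finType) (w : I -> F) d h i0 :
  0 <= h -> w i0 != 0 -> d != 0 -> acts w d h ->
  1 <= `|d| * ((1 + h) ^+ #|I| *+ #|I|`!).
Proof.
move=> h0 w0 d0 [B Bw Bh].
(* Transposed, because the eigenvectors of [eigenvalueP] are rows. *)
pose A := \matrix_(i < #|I|, j < #|I|) B (enum_val j) (enum_val i).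
have Ah i j : `|(map_mx intr A : 'M[F]__) i j| <= h.
  rewrite !mxE; apply: le_trans (Bh (enum_val j)).
  by rewrite (bigD1 (enum_val i)) //= lerDl sumr_ge0.
apply: (@int_poly_root_lower_bound _ (char_poly A)) => //.
- exact: monic_neq0 (char_poly_monic _).
- rewrite map_char_poly -eigenvalue_root_char; apply/eigenvalueP.
  exists (\row_i w (enum_val i)).
    apply/rowP => j; rewrite !mxE Bw.
    rewrite (big_enum_val (fun k => (B (enum_val j) k)%:~R * w k)).
    by apply: eq_bigr => i _; rewrite !mxE mulrC.
  by apply/eqP => /rowP/(_ (enum_rank i0)); rewrite !mxE enum_rankK; exact/eqP.
- move=> m; rewrite map_char_poly.
  apply: le_trans (majorant_sum_coef m (char_poly_majorant h0 Ah)) _.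
  by rewrite hornerMn horner_exp !hornerE.
Qed.

(** The new eigenvector is [w] tensored with [1, a, ..., a ^ (d - 1)], where [d] is the degree of
    [p]. The old matrices act on the first factor, the leading coefficient times [a] on the
    second. *)
Lemma acts_adjoin (I : finType) (w : I -> F) i0 (p : {poly int}) a :
  w i0 != 0 -> p != 0 -> root (map_poly intr p) a ->
  exists (J : finType) (w' : J -> F),
    [/\ exists j, w' j != 0,
        forall d h, acts w d h -> acts w' d h &
        exists (m : int) (h : F), m != 0 /\ acts w' (m%:~R * a) h].
Proof.
move=> w0 p0 pa; pose d := (size p).-1.
have size_p : size p = d.+1 by rewrite prednK // size_poly_gt0.
have d0 : (0 < d)%N.
  rewrite lt0n; apply/eqP => dE.
  have /size_poly1P[c c0 pc] : size p == 1%N by rewrite size_p dE.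
  move: pa; rewrite pc map_polyC rootC /= intr_eq0.
  exact/negP.
pose w' (ij : I * 'I_d) := w ij.1 * a ^+ ij.2.
exists _, w'; split.
- by exists (i0, Ordinal d0); rewrite /w' expr0 mulr1.
- move=> b h [B Bw Bh].
  exists (fun ij kl => if kl.2 == ij.2 then B ij.1 kl.1 else 0) => -[i j].
    rewrite /w' mulrA Bw mulr_suml.
    rewrite -(pair_bigA _ (fun k l => (if l == j then B i k else 0)%:~R * (w k * a ^+ l))).
    apply: eq_bigr => k _ /=; rewrite (bigD1 j) //= eqxx big1 ?addr0 ?mulrA // => l /negbTE ->.
    by rewrite mul0r.
  apply: le_trans (Bh i).
  rewrite -(pair_bigA _ (fun k l => `|(if l == j then B i k else 0)%:~R : F|)) /=.
  apply: ler_sum => k _; rewrite (bigD1 j) //= eqxx big1 ?addr0 // => l /negbTE ->.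
  by rewrite normr0.
(* Companion matrix of [p] scaled by the leading coefficient: a shift, except in the last row, where
   [p(a) = 0] rewrites [lead_coef p * a ^ d]. *)
pose B (ij kl : I * 'I_d) : int :=
  if kl.1 == ij.1 then
    if ij.2.+1 == d then - p`_kl.2 else if kl.2 == ij.2.+1 :> nat then lead_coef p else 0
  else 0.
exists (lead_coef p), (\sum_ij \sum_kl `|(B ij kl)%:~R : F|); split; first by rewrite lead_coef_eq0.
exists B => [[i j]|ij]; last first.
  by rewrite [leRHS](bigD1 ij) //= lerDl sumr_ge0 // => k _; rewrite sumr_ge0.
have -> : \sum_kl (B (i, j) kl)%:~R * w' kl = w i * \sum_(l < d) (B (i, j) (i, l))%:~R * a ^+ l.
  rewrite -(pair_bigA _ (fun k l => (B (i, j) (k, l))%:~R * w' (k, l))) (bigD1 i) //=.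
  rewrite [X in _ + X]big1 ?addr0 => [|k /negbTE ki].
    by rewrite mulr_sumr; apply: eq_bigr => l _; rewrite /w' /= mulrCA.
  by apply: big1 => l _; rewrite /B /= ki mul0r.
rewrite /w' mulrCA /=; congr (_ * _); rewrite -mulrA -exprS.
rewrite /B /= eqxx; case: eqP => jd.
  rewrite jd; move: pa; rewrite /root horner_coef size_map_poly_id0; last first.
    by rewrite intr_eq0 lead_coef_eq0.
  rewrite size_p big_ord_recr /= !coef_map /= addrC addr_eq0 => /eqP.
  rewrite lead_coefE => ->; rewrite -sumrN; apply: eq_bigr => l _.
  by rewrite coef_map rmorphN mulNr.
have jd' : (j.+1 < d)%N by rewrite ltn_neqAle ltn_ord andbT; apply/eqP.
rewrite (bigD1 (Ordinal jd')) //= eqxx big1 ?addr0 // => l.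
by rewrite -val_eqE /= => /negbTE ->; rewrite mul0r.
Qed.

(** Three adjunctions, starting from the eigenvector [1] on a one-point index; the product of the
    three multipliers is the common [D]. *)
Lemma acts_triple (p1 p2 p3 : {poly int}) a1 a2 a3 :
  p1 != 0 -> p2 != 0 -> p3 != 0 -> root (map_poly intr p1) a1 ->
  root (map_poly intr p2) a2 -> root (map_poly intr p3) a3 ->
  exists (J : finType) (w : J -> F) (D : int) (h : F),
    [/\ exists j, w j != 0, D != 0, acts w (D%:~R * a1) h,
        acts w (D%:~R * a2) h & acts w (D%:~R * a3) h].
Proof.
move=> p10 p20 p30 r1 r2 r3.
have [J1 [w1 [[j1 nz1] _ [m1 [h1 [m10 A1]]]]]] :=
  @acts_adjoin unit (fun=> 1) tt _ _ (oner_neq0 _) p10 r1.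
have [J2 [w2 [[j2 nz2] E2 [m2 [h2 [m20 A2]]]]]] := acts_adjoin nz1 p20 r2.
have [J3 [w3 [[j3 nz3] E3 [m3 [h3 [m30 A3]]]]]] := acts_adjoin nz2 p30 r3.
have nn (I : finType) (w : I -> F) (i : I) d h : acts w d h -> 0 <= h.
  by case=> B _ /(_ i); apply: le_trans; rewrite sumr_ge0.
have {E2} A1' := E3 _ _ (E2 _ _ A1); have {E3} A2' := E3 _ _ A2.
have scale m a h : acts w3 a h -> acts w3 (m%:~R * a) (`|m%:~R| * h).
  by move=> H; have h0 := nn _ _ j3 _ _ H; apply: actsM => //; apply: acts_int.
have B1 := scale (m2 * m3) _ _ A1'.
have B2 := scale (m1 * m3) _ _ A2'.
have B3 := scale (m1 * m2) _ _ A3.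
move: B1 B2 B3; set k1 := _ * h1; set k2 := _ * h2; set k3 := _ * h3 => B1 B2 B3.
have [[n1 n2] n3] := (nn _ _ j3 _ _ B1, nn _ _ j3 _ _ B2, nn _ _ j3 _ _ B3).
exists J3, w3, (m1 * m2 * m3), (k1 + k2 + k3); split.
- by exists j3.
- by rewrite !mulf_neq0.
- have -> : (m1 * m2 * m3)%:~R * a1 = (m2 * m3)%:~R * (m1%:~R * a1) by rewrite !rmorphM /=; ring.
  by apply: acts_weaken B1; lra.
- have -> : (m1 * m2 * m3)%:~R * a2 = (m1 * m3)%:~R * (m2%:~R * a2) by rewrite !rmorphM /=; ring.
  by apply: acts_weaken B2; lra.
- have -> : (m1 * m2 * m3)%:~R * a3 = (m1 * m2)%:~R * (m3%:~R * a3) by rewrite !rmorphM /=; ring.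
  by apply: acts_weaken B3; lra.
Qed.
End Acts.

(** * Products of factorials and the choice of the parameter [n] *)

Section FactorialProducts.
Local Open Scope nat_scope.

Lemma bin_le_exp2 n m : 'C(n, m) <= 2 ^ n.
Proof.
case: (leqP m n) => mn; last by rewrite bin_small.
rewrite -[2]/(1 + 1) expnDn (bigD1 (inord m)) //= inordK //.
by rewrite !exp1n !muln1 leq_addr.
Qed.

(** [n ^ n] is at most [(2n)(2n-1)...(n+1) = C(2n, n) n!], and [C(2n, n) <= 4 ^ n]. *)
Lemma expnn_le_fact n : n ^ n <= 4 ^ n * n`!.
Proof.
have : n ^ n <= (n + n) ^_ n.
  rewrite ffact_prod -[X in n ^ X]card_ord -prod_nat_const.
  by apply: leq_prod => i _; rewrite -addnBA ?leq_addr // ltnW.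
move=> h; apply: leq_trans h _; rewrite -bin_ffact leq_mul2r.
by apply/orP; right; rewrite -[4]/(2 ^ 2) -expnM mul2n -addnn bin_le_exp2.
Qed.

Lemma prod_ord_rev_square n (F : nat -> nat) :
  (\prod_(i < n) F i) ^ 2 = \prod_(i < n) (F i * F (n.-1 - i)).
Proof.
rewrite big_split /= -mulnn; congr (_ * _).
rewrite (reindex_inj rev_ord_inj) /=; apply: eq_bigr => i _.
by rewrite subnS -subn1 subnAC subn1.
Qed.

Lemma prod_exp_square n x : (\prod_(i < n) x ^ i) ^ 2 = x ^ (n * n.-1).
Proof.
rewrite prod_ord_rev_square mulnC expnM -[X in _ = _ ^ X]card_ord -prod_nat_const.
apply: eq_bigr => i _; rewrite -expnD subnKC // -ltnS prednK //.
exact: leq_ltn_trans (ltn_ord i).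
Qed.

(** Pairing [i] with [n-1-i] gives [i! (n-1-i)! = (n-1)! / C(n-1, i)], where
    [(n-1)! >= n ^ (n-1) / 4 ^ n] and the binomial is at most [2 ^ n]. *)
Lemma prod_fact_lower_bound n :
  n ^ (n * n.-1) <= 8 ^ (n * n) * (\prod_(i < n) i`!) ^ 2.
Proof.
case: (posnP n) => [->|n0]; first by rewrite big_ord0.
have hp i : i < n -> n ^ n.-1 <= 8 ^ n * (i`! * (n.-1 - i)`!).
  move=> i_n; have := expnn_le_fact n.
  rewrite -{2 4}(prednK n0) expnS factS prednK // mulnCA leq_pmul2l //.
  have i_n1 : i <= n.-1 by rewrite -ltnS prednK.
  rewrite -(bin_fact i_n1) => h; apply: leq_trans h _.
  rewrite -[8]/(4 * 2) expnMn -mulnA leq_mul2l; apply/orP; right.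
  rewrite leq_mul2r; apply/orP; right; apply: leq_trans (bin_le_exp2 _ _) _.
  by rewrite leq_pexp2l // leq_pred.
have E x : x ^ n = \prod_(i < n) x by rewrite prod_nat_const card_ord.
rewrite (prod_ord_rev_square _ factorial) mulnC expnM [8 ^ _]expnM E [(8 ^ n) ^ n]E.
by rewrite -big_split; apply: leq_prod => i _; exact: hp.
Qed.

(** Put [L = n ^ 4] and [M = n ^ 3]. Squared, the right side is about
    [L ^ (L * L) = n ^ (4 * L * L)], while the left side is about [M ^ (L * L) = n ^ (3 * L * L)],
    up to constants to the power [L * L] and powers of [n] with exponent [O(M * L)]. *)
Lemma gelfond_schneider_parameters (c G W K N : nat) : 0 < c -> 0 < W ->
  exists2 n, 0 < n &
    (\prod_(i < n ^ 4) (2 * (c * n ^ 2)) ^ i) *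
    (\prod_(i < n ^ 4) ((c * n ^ 2 * G) ^ (n ^ 3) * (n * W) ^ i)) * (n ^ 4)`! *
    ((K ^ (3 * n ^ 3)) ^ n ^ 4 * (1 + ((2 * n ^ 2 * K) ^ (3 * n ^ 3)) ^ n ^ 4 * (n ^ 4)`!) ^ N * N`!)
    < \prod_(i < n ^ 4) i`!.
Proof.
(* [B = 8 * (2 * c * W)] gathers the constants raised to the power [L * L]; as [B ^ 2 <= n], they
   cost only half of the gain. The bound [50 + 68 * N < n] settles the final comparison of
   exponents. *)
move=> c0 W0; pose B := 16 * c * W; pose n := B ^ 2 + c + G + K + N`! + 51 + 68 * N.
exists n; first by rewrite /n; lia.
have nB : B ^ 2 <= n by rewrite /n; lia.
have [nc nG nK nN] : [/\ c <= n, G <= n, K <= n & N`! <= n] by rewrite /n; split; lia.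
have n2 : 2 <= n by rewrite /n; lia.
have nbig : 50 + 68 * N < n by rewrite /n; lia.
have n0 : 0 < n by lia.
move: n nB nc nG nK nN n2 nbig n0 => n nB nc nG nK nN n2 nbig n0.
set L := n ^ 4; set M := n ^ 3.
have L0 : 0 < L by rewrite expn_gt0 n0.
have M0 : 0 < M by rewrite expn_gt0 n0.
have LM : L = n * M by rewrite -expnS.
rewrite ltnNge; apply/negP; set Pf := \prod_(i < L) i`!.
set Z1 := \prod_(i < L) _; set Z2 := \prod_(i < L) _ => H.
have factL : L`! <= n ^ (4 * (M * L)).
  apply: leq_trans (_ : L ^ L <= _).
    rewrite -[X in L ^ X]card_ord -prod_nat_const fact_prod big_add1 big_mkord.
    by apply: leq_prod => i _.
  by rewrite /L -expnM leq_pexp2l // leq_mul2l /= leq_pmull.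
have pw a b e : a <= n ^ b -> a ^ e <= n ^ (b * e).
  by move=> ab; rewrite expnM; case: e => // e; rewrite leq_exp2r.
have pw1 a e : a <= n -> a ^ e <= n ^ e by rewrite -{2}[e]mul1n => an; apply: (@pw).
pose ML := M * L.
have Z2le : Z2 = (c * n ^ 2 * G) ^ ML * \prod_(i < L) (n * W) ^ i.
  by rewrite /Z2 big_split /= prod_nat_const card_ord -expnM.
set Z3 := (_ ^ _) ^ L * _ ^ N * N`! in H.
have nX a b : n ^ a * n ^ b = n ^ (a + b) by rewrite expnD.
have nXle a b : a <= b -> n ^ a <= n ^ b by exact: leq_pexp2l.
have ML0 : 0 < ML by rewrite muln_gt0 M0.
have Z3le : Z3 <= n ^ (3 * ML + 17 * ML * N + ML).
  rewrite /Z3 (expnD n (3 * ML + _)) (expnD n (3 * ML)); apply: leq_mul; last first.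
    by apply: leq_trans nN _; rewrite -{1}[n]expn1 nXle.
  apply: leq_mul.
    by rewrite -expnM -(mulnA 3) -/ML pw1.
  apply: (@pw); apply: leq_trans (_ : _ <= n ^ (16 * ML) * 2) _.
    rewrite muln2 -addnn; apply: leq_add; first by rewrite expn_gt0 n0.
    have -> : 16 * ML = 4 * (3 * ML) + 4 * ML by lia.
    rewrite (expnD n (4 * (3 * ML))); apply: (leq_mul _ factL); rewrite -expnM -(mulnA 3) -/ML; apply: (@pw).
    have -> : n ^ 4 = n * n ^ 2 * n by rewrite -expnS -expnSr.
    by rewrite !leq_mul.
  have -> : 17 * ML = 16 * ML + ML by lia.
  rewrite (expnD n (16 * ML)) leq_mul2l; apply/orP; right; apply: leq_trans n2 _.
  by rewrite -{1}[n]expn1 nXle.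
have Yle : (c * n ^ 2 * G) ^ ML * L`! * Z3 <= n ^ ((12 + 17 * N) * ML).
  have -> : (12 + 17 * N) * ML = 4 * ML + 4 * ML + (3 * ML + 17 * ML * N + ML) by lia.
  rewrite (expnD n (4 * ML + _)) (expnD n (4 * ML)); apply: (leq_mul _ Z3le); apply: (leq_mul _ factL); apply: (@pw).
  have -> : n ^ 4 = n * n ^ 2 * n by rewrite -expnS -expnSr.
  by rewrite !leq_mul.
pose V := \prod_(i < L) (2 * c * W * M) ^ i.
have H1 : Pf <= V * n ^ ((12 + 17 * N) * ML).
  apply: leq_trans H _; apply: leq_trans (_ : _ <= V * ((c * n ^ 2 * G) ^ ML * L`! * Z3)) _; last first.
    by rewrite leq_mul2l Yle orbT.
  have -> : V = Z1 * \prod_(i < L) (n * W) ^ i.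
    rewrite /V /Z1 -big_split; apply: eq_bigr => i _ /=; rewrite -expnMn; congr (_ ^ _).
    by rewrite /M expnS; lia.
  by rewrite Z2le; lia.
have H2 : n ^ (4 * (L * L.-1)) <=
    8 ^ (L * L) * ((2 * c * W * M) ^ (L * L.-1) * n ^ (2 * ((12 + 17 * N) * ML))).
  rewrite expnM -/L; apply: leq_trans (prod_fact_lower_bound L) _.
  rewrite leq_mul2l; apply/orP; right; rewrite -/Pf -prod_exp_square -/V.
  by rewrite [2 * (_ * ML)]mulnC expnM -expnMn leq_exp2r.
(* Cancelling [M ^ (L * L.-1) = n ^ (3 * (L * L.-1))] leaves the gain on the left. *)
have H3 : n ^ (L * L.-1) <= B ^ (L * L) * n ^ (2 * ((12 + 17 * N) * ML)).
  have nM0 : 0 < n ^ (3 * (L * L.-1)) by rewrite expn_gt0 n0.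
  rewrite -(leq_pmul2l nM0) nX -mulSnr; apply: leq_trans H2 _.
  rewrite [n ^ (3 * _)]expnM -/M [(_ * M) ^ _]expnMn.
  rewrite [leqLHS](_ : _ = M ^ (L * L.-1) *
    (8 ^ (L * L) * (2 * c * W) ^ (L * L.-1) * n ^ (2 * ((12 + 17 * N) * ML)))); last by lia.
  rewrite leq_mul2l; apply/orP; right; rewrite leq_mul2r; apply/orP; right.
  have -> : B = 8 * (2 * c * W) by rewrite /B; lia.
  rewrite (expnMn 8) leq_mul2l; apply/orP; right; apply: leq_pexp2l.
    by rewrite !muln_gt0 c0 W0.
  by rewrite leq_mul2l leq_pred orbT.
have H4 : n ^ (2 * (L * L.-1)) <= n ^ (L * L + 4 * ((12 + 17 * N) * ML)).
  rewrite mulnC expnM; apply: leq_trans (_ : _ <= (B ^ (L * L) * n ^ (2 * ((12 + 17 * N) * ML))) ^ 2) _.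
    by rewrite leq_exp2r.
  rewrite expnMn expnD -!expnM; apply: leq_mul; last by apply: nXle; lia.
  by rewrite mulnC expnM pw1.
move: H4; rewrite leq_exp2l // /ML => H4.
have H5 : 2 * L.-1 <= L + 4 * ((12 + 17 * N) * M).
  rewrite -(leq_pmul2l L0); nia.
have H6 : L <= (50 + 68 * N) * M.
  by move: H5 M0; clear; clearbody L M; lia.
by move: H6; rewrite LM leq_pmul2r // leqNgt nbig.
Qed.
End FactorialProducts.

(** * Interpolation determinants *)

Section Rolle.

Lemma derivable_pt_limD (f g : R -> R) (x a b : R) :
  derivable_pt_lim f x a -> derivable_pt_lim g x b ->
  derivable_pt_lim (fun y => f y + g y) x (a + b).
Proof. exact: derivable_pt_lim_plus. Qed.

Lemma derivable_pt_limM (f g : R -> R) (x a b : R) :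
  derivable_pt_lim f x a -> derivable_pt_lim g x b ->
  derivable_pt_lim (fun y => f y * g y) x (a * g x + f x * b).
Proof. exact: derivable_pt_lim_mult. Qed.

Lemma derivable_pt_limZ (c : R) (f : R -> R) (x a : R) :
  derivable_pt_lim f x a -> derivable_pt_lim (fun y => c * f y) x (c * a).
Proof. exact: derivable_pt_lim_scal. Qed.

Lemma derivable_pt_lim_sum (I : Type) (s : seq I) (f : I -> R -> R) (x : R) (a : I -> R) :
  (forall i, derivable_pt_lim (f i) x (a i)) ->
  derivable_pt_lim (fun y => \sum_(i <- s) f i y) x (\sum_(i <- s) a i).
Proof.
move=> h; elim: s => [|i s IH].
  rewrite big_nil; apply: (derivable_pt_lim_ext (fun=> 0)) => [y|]; first by rewrite big_nil.
  exact: derivable_pt_lim_const.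
rewrite big_cons.
apply: (derivable_pt_lim_ext (fun y => f i y + \sum_(i <- s) f i y)) => [y|].
  by rewrite big_cons.
exact: derivable_pt_limD.
Qed.

Lemma derivable_pt_lim_horner (p : {poly R}) (x : R) :
  derivable_pt_lim (fun y => p.[y]) x p^`().[x].
Proof.
elim/poly_ind: p => [|p c IH].
  rewrite deriv0 hornerC.
  apply: (derivable_pt_lim_ext (fun=> 0)) => [y|]; first by rewrite hornerC.
  exact: derivable_pt_lim_const.
apply: (derivable_pt_lim_ext (fun y => p.[y] * y + c)) => [y|]; first by rewrite !hornerE.
have -> : (p * 'X + c%:P)^`().[x] = (p^`().[x] * x + p.[x] * 1) + 0.
  by rewrite derivD derivC addr0 derivM derivX mulr1 !hornerE.
apply: derivable_pt_limD (derivable_pt_lim_const _ _).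
exact: derivable_pt_limM (derivable_pt_lim_id _).
Qed.

Variables lo hi : R.

(** Smooth functions are carried as the sequence of their derivatives, so that Rolle's theorem is
    iterated by shifting the sequence. *)
Definition derivative_sequence (g : nat -> R -> R) :=
  forall i x, derivable_pt_lim (g i) x (g i.+1 x).

Lemma rolle_path (f f' : R -> R) (x : R) (s : seq R) :
  (forall y, derivable_pt_lim f y (f' y)) ->
  path <%R x s -> lo <= x -> all (<= hi) s -> f x = 0 -> (forall y, y \in s -> f y = 0) ->
  exists s' : seq R, [/\ size s' = size s, path <%R x s', all (<= hi) s' &
    forall y, y \in s' -> f' y = 0].
Proof.
move=> df; elim: s x => [|y s IH] x; first by exists [::].
move=> /= /andP[xy ys] lox /andP[yhi shi] fx fs.
have fy : f y = 0 by apply: fs; rewrite mem_head.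
have loy : lo <= y by apply: le_trans lox (ltW xy).
have [|s' [szs' ys' s'hi f's']] := IH y ys loy shi fy.
  by move=> z zs; apply: fs; rewrite inE zs orbT.
have [z [fz [xz zy]]] := MVT_cor2 f f' x y (elimT RltP xy) (fun c _ => df c).
move: fz xz zy; rewrite fx fy !RealsE subrr => /esym/eqP.
rewrite mulf_eq0 subr_eq0 [y == x]gt_eqF // orbF => /eqP f'z /RltP xz /RltP zy.
exists (z :: s'); split => /=.
- by rewrite szs'.
- rewrite xz; case: s' ys' {szs' s'hi f's'} => //= t s' /andP[yt ->].
  by rewrite (lt_trans zy yt).
- by rewrite s'hi (le_trans (ltW zy)).
- by move=> t; rewrite inE => /orP[/eqP -> //|]; apply: f's'.
Qed.

Lemma rolle_sorted (g : nat -> R -> R) m (s : seq R) :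
  derivative_sequence g -> sorted <%R s -> all (fun y => lo <= y <= hi) s ->
  (forall y, y \in s -> g 0%N y = 0) ->
  exists s' : seq R, [/\ size s' = (size s - m)%N, sorted <%R s',
    all (fun y => lo <= y <= hi) s' & forall y, y \in s' -> g m y = 0].
Proof.
move=> dg; elim: m g dg s => [|m IH] g dg s ss shi gs.
  by exists s; rewrite subn0.
have [s1 [sz1 ss1 s1hi gs1]] : exists s' : seq R, [/\ size s' = (size s).-1,
    sorted <%R s', all (fun y => lo <= y <= hi) s' & forall y, y \in s' -> g 1%N y = 0].
  case: s ss shi gs => [|x s] /= ss; first by exists [::].
  move=> /andP[/andP[lox xhi] shi] gs.
  have [] := rolle_path (dg 0%N) ss lox _ (gs x (mem_head _ _)).
  - by apply: sub_all shi => y /andP[].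
  - by move=> y ys; apply: gs; rewrite inE ys orbT.
  move=> s' [sz' xs' s'hi gs']; exists s'; split => //.
    exact: path_sorted xs'.
  move: xs'; rewrite (path_sortedE lt_trans) => /andP[/allP xs' _].
  apply/allP => y ys'; have yh : y <= hi := allP s'hi _ ys'; rewrite yh andbT.
  exact: le_trans lox (ltW (xs' _ ys')).
have [s2 [sz2 ss2 s2hi gs2]] := IH (fun i => g i.+1) (fun i => dg i.+1) s1 ss1 s1hi gs1.
by exists s2; split=> //; rewrite sz2 sz1 -subn1 -subnDA add1n.
Qed.

Lemma rolle_uniq (g : nat -> R -> R) m (s : seq R) :
  derivative_sequence g -> uniq s -> all (fun y => lo <= y <= hi) s ->
  (forall y, y \in s -> g 0%N y = 0) ->
  exists s' : seq R, [/\ size s' = (size s - m)%N, uniq s',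
    all (fun y => lo <= y <= hi) s' & forall y, y \in s' -> g m y = 0].
Proof.
move=> dg us shi gs.
have [|||s' [sz' ss' s'hi gs']] := @rolle_sorted g m (sort <=%R s) dg.
- by rewrite sort_lt_sorted.
- by rewrite all_sort.
- by move=> y; rewrite mem_sort; apply: gs.
exists s'; split => //; last exact: lt_sorted_uniq.
by rewrite sz' size_sort.
Qed.

Lemma derivn_monic_const (p : {poly R}) m (x : R) :
  p \is monic -> size p = m.+1 -> p^`(m).[x] = m`!%:R.
Proof.
move=> pm sp.
have -> : p^`(m) = (m`!%:R)%:P.
  apply/polyP => i; rewrite coef_derivn coefC; case: i => [|i] /=.
    rewrite addn0 ffactnn.
    by move: pm; rewrite monicE lead_coefE sp /= => /eqP ->.
  by rewrite nth_default ?mul0rn // sp addnS ltnS leq_addr.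
by rewrite hornerC.
Qed.

(** Subtracting from [g] a multiple of the monic polynomial [p] with roots [s] gives a function that
    also vanishes at [y]. Its derivative of order [size s] has a zero by Rolle, and there [p]
    contributes [(size s)!]. *)
Lemma interpolation_mean_value (g : nat -> R -> R) (s : seq R) y :
  derivative_sequence g -> uniq s -> all (fun y => lo <= y <= hi) s ->
  lo <= y <= hi -> (forall z, z \in s -> g 0%N z = 0) ->
  exists2 xi, lo <= xi <= hi &
    g 0%N y * (size s)`!%:R = g (size s) xi * \prod_(z <- s) (y - z).
Proof.
move=> dg us shi yhi gs; set m := size s.
case: (boolP (y \in s)) => ys.
  exists y => //; rewrite gs // mul0r.
  by rewrite (perm_big _ (perm_to_rem ys)) big_cons /= subrr mul0r mulr0.
pose p : {poly R} := \prod_(z <- s) ('X - z%:P).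
have py0 : p.[y] != 0 by rewrite horner_prod prodf_seq_neq0; apply/allP => z zs /=;
  rewrite !hornerE subr_eq0; apply: contraNneq ys => ->.
pose G i x := g i x + (- (g 0%N y / p.[y])) * p^`(i).[x].
have dG : derivative_sequence G.
  move=> i x; apply: derivable_pt_limD => //; apply: derivable_pt_limZ.
  by rewrite derivnS; apply: derivable_pt_lim_horner.
have [|||s' [sz' _ s'hi Gs']] := @rolle_uniq G m (y :: s) dG.
- by rewrite /= ys.
- by rewrite /= yhi.
- move=> z; rewrite inE => /orP[/eqP ->|zs]; rewrite /G derivn0.
    by rewrite mulNr mulfVK // subrr.
  rewrite gs // add0r.
  suff -> : p.[z] = 0 by rewrite mulr0.
  by apply/eqP; rewrite -[_ == 0]/(root p z) root_prod_XsubC.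
case: s' sz' s'hi Gs' => [|xi s']; first by rewrite /= subSnn.
move=> _ /= /andP[xihi _] /(_ xi (mem_head _ _)) /eqP.
rewrite /G addr_eq0 mulNr opprK derivn_monic_const ?monic_prod_XsubC ?size_prod_XsubC //.
move=> /eqP gxi; exists xi => //; rewrite gxi.
have -> : \prod_(z <- s) (y - z) = p.[y].
  by rewrite horner_prod; apply: eq_bigr => z _; rewrite !hornerE.
by rewrite mulrAC mulfVK.
Qed.
End Rolle.

Section InterpolationDeterminant.

Definition replace_row (S : Type) n (A : 'M[S]_n) (r : 'I_n) (v : 'I_n -> S) : 'M_n :=
  \matrix_(i, j) if i == r then v j else A i j.

(** Cofactors along row [r] ignore that row; so the determinant, as a function of one node, can be
    differentiated term by term. *)
Lemma det_replace_row (S : comNzRingType) n (A : 'M[S]_n) r v :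
  \det (replace_row A r v) = \sum_j cofactor A r j * v j.
Proof.
rewrite (expand_det_row _ r); apply: eq_bigr => j _; rewrite mxE eqxx mulrC.
congr (_ * _); rewrite /cofactor; congr (_ * \det _).
by apply/matrixP => i k; rewrite !mxE eq_sym (negbTE (neq_lift _ _)).
Qed.

Lemma det_norm_bound (F : realFieldType) n (A : 'M[F]_n) (b : 'I_n -> F) :
  (forall i j, `|A i j| <= b i) -> `|\det A| <= (\prod_i b i) *+ n`!.
Proof.
move=> hA; rewrite -card_Sn -sumr_const.
apply: le_trans (ler_norm_sum _ _ _) (ler_sum _ _) => s _.
rewrite normrM normrX normrN1 expr1n mul1r normr_prod.
by apply: ler_prod => i _; rewrite normr_ge0 hA.
Qed.

Variables (L : nat) (X : R) (f : 'I_L -> nat -> R -> R) (x : 'I_L -> R).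
Hypothesis df : forall l, derivative_sequence (f l).
Hypothesis x_inj : injective x.
Hypothesis xX : forall m, - X <= x m <= X.

(** Passes from the interpolation matrix, at [k = L], to the matrix whose row [m] consists of [m]-th
    derivatives, at [k = 0]. *)
Let mixed k (xi : 'I_L -> R) : 'M[R]_L :=
  \matrix_(m, l) if (m < k)%N then f l 0%N (x m) else f l m (xi m).

(* As a function of the point in row [k], the determinant vanishes at the first [k] nodes. *)
Lemma interpolation_det_step k xi (r : 'I_L) : r = k :> nat ->
  (forall m, - X <= xi m <= X) ->
  exists2 xi', forall m, - X <= xi' m <= X &
    `|\det (mixed k.+1 xi)| * k`!%:R <= (2 * X) ^+ k * `|\det (mixed k xi')|.
Proof.
move=> rk xiX; set A := mixed k.+1 xi.
pose g i y := \det (replace_row A r (fun l => f l i y)).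
have dg : derivative_sequence g.
  move=> i y; rewrite /g det_replace_row.
  apply: (derivable_pt_lim_ext (fun y => \sum_j cofactor A r j * f j i y)) => [z|].
    by rewrite det_replace_row.
  by apply: derivable_pt_lim_sum => j; apply: derivable_pt_limZ; apply: df.
have kL : (k <= L)%N by rewrite -rk ltnW.
pose s := [seq x (widen_ord kL i) | i <- enum 'I_k].
have ss : size s = k by rewrite size_map size_enum_ord.
have us : uniq s.
  rewrite map_inj_uniq ?enum_uniq // => i j /x_inj /(congr1 val) /= ij.
  exact: val_inj.
have sX : all (fun y => - X <= y <= X) s by apply/allP => _ /mapP[i _ ->]; apply: xX.
have gs z : z \in s -> g 0%N z = 0.
  (* At an earlier node [x i] the rows [i] and [r] coincide. *)
  case/mapP=> i _ ->; apply: (@determinant_alternate _ _ _ (widen_ord kL i) r).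
    by rewrite -val_eqE /= rk neq_ltn ltn_ord.
  move=> j; rewrite !mxE eqxx -val_eqE /= rk (ltn_eqF (ltn_ord i)).
  by rewrite ltnW // ltnS.
have [t tX gt] := interpolation_mean_value dg us sX (xX r) gs.
exists (fun m => if m == r then t else xi m) => [m|]; first by case: eqP.
have gA : g 0%N (x r) = \det A.
  rewrite /g; congr (\det _); apply/matrixP => m l; rewrite !mxE.
  by case: eqP => // ->; rewrite rk ltnSn.
have gk : g k t = \det (mixed k (fun m => if m == r then t else xi m)).
  rewrite /g; congr (\det _); apply/matrixP => m l; rewrite !mxE.
  rewrite -val_eqE /= rk ltnS; by case: (ltngtP m k) => // ->.
rewrite -gA -gk -[k`!%:R]normr_nat -normrM -ss gt normrM ss mulrC.
apply: ler_wpM2r => //; rewrite normr_prod -[k in leRHS]ss.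
have X0 : 0 <= X by have /andP[] := xX r; lra.
elim: (s) sX => [|z s' IH] /=; first by rewrite big_nil expr0.
move=> /andP[zX s'X]; rewrite big_cons exprS ler_pM ?IH // ?prodr_ge0 //.
rewrite ler_norml; have /andP[] := xX r; have /andP[] := zX; lra.
Qed.

Lemma interpolation_det_mixed j : (j <= L)%N ->
  exists2 xi, forall m, - X <= xi m <= X &
    `|\det (\matrix_(m, l) f l 0%N (x m))| * \prod_(L - j <= m < L) m`!%:R
      <= (\prod_(L - j <= m < L) (2 * X) ^+ m) * `|\det (mixed (L - j) xi)|.
Proof.
elim: j => [|j IH] jL.
  exists x => //; rewrite subn0 !big_geq // mul1r mulr1.
  suff -> : \matrix_(m, l) f l 0%N (x m) = mixed L x by [].
  by apply/matrixP => m l; rewrite !mxE ltn_ord.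
have [xi xiX] := IH (ltnW jL).
have kE : (L - j = (L - j.+1).+1)%N by rewrite subnSK.
have rL : (L - j.+1 < L)%N by rewrite ltn_subrL /= (leq_trans _ jL).
rewrite kE; set k := (L - j.+1)%N in rL *; move=> H.
have [xi' xi'X K] := @interpolation_det_step k xi (Ordinal rL) erefl xiX.
exists xi' => //; rewrite !(big_ltn rL).
have X0 : 0 <= 2 * X by have /andP[] := xX (Ordinal rL); lra.
rewrite mulrCA; apply: le_trans (ler_wpM2l (ler0n _ _) H) _.
rewrite mulrCA [leRHS]mulrAC [leRHS]mulrC; apply: ler_wpM2l.
  by apply: prodr_ge0 => i _; exact: exprn_ge0.
by rewrite mulrC.
Qed.

(** After [L] steps every row consists of derivatives; the factors [m!] gathered on the left are
    what makes the determinant small. *)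
Lemma interpolation_det_bound (E Y : R) :
  (forall l m t, - X <= t <= X -> `|f l m t| <= E * Y ^+ m) ->
  `|\det (\matrix_(m, l) f l 0%N (x m))| * \prod_(m < L) m`!%:R
    <= ((\prod_(m < L) (2 * X) ^+ m) * (\prod_(m < L) (E * Y ^+ m))) *+ L`!.
Proof.
move=> fE; have [xi xiX] := interpolation_det_mixed (leqnn L).
rewrite subnn !big_mkord => H; apply: le_trans H _.
rewrite -mulrnAr; apply: ler_wpM2l.
  case: (posnP L) => [L0|L0]; first by apply: prodr_ge0 => i; have := ltn_ord i; rewrite {2}L0.
  have X0 : 0 <= 2 * X by have /andP[] := xX (Ordinal L0); lra.
  by apply: prodr_ge0 => i _; exact: exprn_ge0.
by apply: det_norm_bound => m l; rewrite mxE ltn0; apply: fE.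
Qed.
End InterpolationDeterminant.

(** * Exponential polynomials: growth of derivatives and number of zeros *)

Section ExponentialPolynomials.

Definition exp_deriv (w : R) (P : {poly R}) : {poly R} := P^`() + w *: P.

Definition exp_poly (w : R) (P : {poly R}) (i : nat) (x : R) :=
  (iter i (exp_deriv w) P).[x] * exp (w * x).

Lemma exp_add (x y : R) : exp (x + y) = exp x * exp y.
Proof. exact: exp_plus. Qed.

Lemma exp_gt0 (x : R) : 0 < exp x.
Proof. by apply/RltP; apply: exp_pos. Qed.

Lemma exp_homo : {homo exp : x y / x <= y}.
Proof.
move=> x y; rewrite le_eqVlt => /orP[/eqP -> //|/RltP xy].
by apply: ltW; apply/RltP; apply: exp_increasing.
Qed.

Lemma derivable_pt_lim_expZ (w x : R) :
  derivable_pt_lim (fun y => exp (w * y)) x (exp (w * x) * (w * 1)).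
Proof.
apply: (derivable_pt_lim_comp (fun y => w * y) exp); last exact: derivable_pt_lim_exp.
exact: derivable_pt_limZ (derivable_pt_lim_id _).
Qed.

Lemma exp_poly_derivative w P : derivative_sequence (exp_poly w P).
Proof.
move=> i x; rewrite /exp_poly iterS; set Q := iter i _ P.
have -> : (exp_deriv w Q).[x] * exp (w * x) =
    Q^`().[x] * exp (w * x) + Q.[x] * (exp (w * x) * (w * 1)).
  by rewrite /exp_deriv hornerD hornerZ; ring.
exact: derivable_pt_limM (derivable_pt_lim_horner _ _) (derivable_pt_lim_expZ _ _).
Qed.

Lemma size_exp_deriv w P i : (size (iter i (exp_deriv w) P) <= size P)%N.
Proof.
elim: i => //= i /leq_sizeP IH; apply/leq_sizeP => j hj.
by rewrite coefD coef_deriv coefZ !IH ?mulr0 ?mul0rn ?addr0 // leqW.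
Qed.

(** For [w != 0] the operator multiplies the leading coefficient by [w], so it never lowers the
    degree. *)
Lemma exp_deriv_eq0 w P i : w != 0 -> iter i (exp_deriv w) P = 0 -> P = 0.
Proof.
move=> w0; elim: i => //= i IH; set Q := iter i _ P in IH *.
move=> /polyP/(_ (size Q).-1); rewrite coefD coef_deriv coefZ coef0.
rewrite [Q`_(size Q).-1.+1]nth_default ?leqSpred // mul0rn add0r.
by move=> /eqP; rewrite mulf_eq0 (negbTE w0) /= -lead_coefE lead_coef_eq0 => /eqP.
Qed.

(** In the norm with weights [X ^ j], differentiation in degree at most [U] has norm at most
    [U / X <= v]. *)
Lemma exp_deriv_bound (U : nat) (X v w : R) (P : {poly R}) i :
  0 < X -> 0 <= v -> U%:R <= v * X -> (size P <= U.+1)%N ->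
  \sum_(j < U.+1) `|(iter i (exp_deriv w) P)`_j| * X ^+ j
    <= (`|w| + v) ^+ i * \sum_(j < U.+1) `|P`_j| * X ^+ j.
Proof.
move=> X0 v0 UX sP; elim: i => [|i IH]; first by rewrite mul1r.
rewrite exprS -mulrA; apply: le_trans (ler_wpM2l _ IH); last by rewrite addr_ge0.
have {IH sP} := leq_trans (size_exp_deriv w P i) sP.
rewrite iterS; move: (iter i _ P) => Q sQ.
rewrite mulrDl addrC.
apply: le_trans (_ : _ <= \sum_(j < U.+1) (`|Q^`()`_j| * X ^+ j + `|w| * (`|Q`_j| * X ^+ j))) _.
  apply: ler_sum => j _; rewrite mulrA -mulrDl; apply: ler_wpM2r; first exact/exprn_ge0/ltW.
  by rewrite coefD coefZ -normrM ler_normD.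
rewrite big_split /= -mulr_sumr; apply: lerD => //.
rewrite big_ord_recr /= coef_deriv [Q`_U.+1]nth_default // mul0rn normr0 mul0r addr0.
rewrite big_ord_recl mulrDr; apply: ler_wpDl.
  by rewrite mulr_ge0 // mulr_ge0.
rewrite mulr_sumr; apply: ler_sum => j _.
rewrite coef_deriv normrMn -mulr_natl exprS [X in _ <= X]mulrCA -!mulrA [leLHS]mulrCA.
apply: ler_wpM2l => //; rewrite mulrA; apply: ler_wpM2r; first exact/exprn_ge0/ltW.
by apply: le_trans UX; rewrite ler_nat.
Qed.

Lemma exp_poly_monomial_bound (U : nat) (X v w : R) u i t :
  1 <= X -> 0 <= v -> U%:R <= v * X -> (u <= U)%N -> - X <= t <= X ->
  `|exp_poly w 'X^u i t| <= X ^+ U * exp (`|w| * X) * (`|w| + v) ^+ i.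
Proof.
move=> X1 v0 UX uU tX; have X0 : 0 < X by lra.
have ht : `|t| <= X by rewrite ler_norml.
rewrite /exp_poly normrM [leRHS]mulrAC.
have sP : (size ('X^u : {poly R}) <= U.+1)%N by rewrite size_polyXn ltnS.
apply: ler_pM => //.
  rewrite [X ^+ U * _]mulrC; apply: le_trans (_ : _ <= (`|w| + v) ^+ i *
      \sum_(j < U.+1) `|('X^u : {poly R})`_j| * X ^+ j) _; last first.
    apply: ler_wpM2l; first by rewrite exprn_ge0 // addr_ge0.
    rewrite (bigD1 (inord u)) //= inordK // coefXn eqxx normr1 mul1r big1 ?addr0.
      exact: ler_weXn2l.
    move=> j; rewrite -val_eqE /= inordK // coefXn => /negbTE ->.
    by rewrite normr0 mul0r.
  apply: le_trans _ (exp_deriv_bound w i X0 v0 UX sP).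
  rewrite (horner_coef_wide _ (leq_trans (size_exp_deriv w _ i) sP)).
  apply: le_trans (ler_norm_sum _ _ _) (ler_sum _ _) => j _.
  rewrite normrM normrX; apply: ler_wpM2l => //.
  by rewrite lerXn2r ?nnegrE ?(ltW X0).
rewrite ger0_norm; last exact/ltW/exp_gt0.
apply: exp_homo; apply: le_trans (ler_norm _) _.
by rewrite normrM ler_wpM2l.
Qed.

(** Induction on the number of exponents: dividing by the last exponential and differentiating [U]
    times kills the last polynomial and costs [U] zeros. The others vanish by induction and
    [exp_deriv_eq0], and the last one then has too many roots. *)
Lemma exp_poly_zeros (lo hi : R) (U T : nat) (w : nat -> R) (P : nat -> {poly R}) (s : seq R) :
  (forall i j, (i < T)%N -> (j < T)%N -> w i = w j -> i = j) ->
  (forall t, (size (P t) <= U)%N) -> uniq s -> (U * T <= size s)%N ->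
  all (fun y => lo <= y <= hi) s ->
  (forall x, x \in s -> \sum_(t < T) (P t).[x] * exp (w t * x) = 0) ->
  forall t, (t < T)%N -> P t = 0.
Proof.
elim: T w P s => // T IH w P s w_inj sP us ss shi Ps.
pose G i x := \sum_(t < T) exp_poly (w t - w T) (P t) i x + (P T)^`(i).[x].
have dG : derivative_sequence G.
  move=> i x; apply: derivable_pt_limD; last by rewrite derivnS; apply: derivable_pt_lim_horner.
  by apply: derivable_pt_lim_sum => t; apply: exp_poly_derivative.
have G0 x : x \in s -> G 0%N x = 0.
  move=> xs; have : G 0%N x = exp (- w T * x) * \sum_(t < T.+1) (P t).[x] * exp (w t * x).
    rewrite big_ord_recr mulrDr mulr_sumr /G /exp_poly; congr (_ + _).
      apply: eq_bigr => t _; rewrite mulrCA /= -exp_add.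
      by rewrite mulrDl addrC.
    by rewrite mulrCA /= -exp_add mulNr addNr exp_0 mulr1.
  by move=> ->; rewrite Ps // mulr0.
have [s' [sz' us' s'hi Gs']] := rolle_uniq U dG us shi G0.
have PT : forall t, (t < T)%N -> P t = 0.
  move=> t tT; have wt : w t - w T != 0.
    rewrite subr_eq0; apply/eqP => /w_inj tE.
    by have := tE (ltnW tT) (ltnSn _); move: tT => /[swap] ->; rewrite ltnn.
  apply: (@exp_deriv_eq0 (w t - w T) _ U) => //.
  apply: (IH (fun t => w t - w T) (fun t => iter U (exp_deriv (w t - w T)) (P t)) s') => //.
  - by move=> i j iT jT /addIr; apply: w_inj; exact: leqW.
  - by move=> i; apply: leq_trans (size_exp_deriv _ _ _) (sP i).
  - by rewrite sz' leq_subRL ?(leq_trans _ ss) // ?mulnS ?leq_addr.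
  - move=> x xs'; have := Gs' x xs'; rewrite /G.
    have -> : (P T)^`(U) = 0.
      by apply/polyP => i; rewrite coef_derivn coef0 nth_default ?mul0rn // (leq_trans (sP T)) ?leq_addr.
    by rewrite horner0 addr0.
move=> t; rewrite ltnS leq_eqVlt => /orP[/eqP ->|]; last exact: PT.
apply: (@roots_geq_poly_eq0 _ _ s) => //.
  apply/allP => x xs; have := Ps x xs.
  rewrite big_ord_recr big1 /= ?add0r; last by move=> i _; rewrite PT // horner0 mul0r.
  move=> /eqP; rewrite mulf_eq0 => /orP[//|/eqP e0].
  by have := exp_pos (w T * x); rewrite e0 => /Rlt_irrefl.
by apply: leq_trans (sP T) (leq_trans _ ss); rewrite leq_pmulr.
Qed.
End ExponentialPolynomials.

(** * The real Gelfond-Schneider theorem *)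

Section GelfondSchneider.

Variables (alpha beta : R).
Hypothesis alpha_gt0 : 0 < alpha.
Hypothesis alpha_neq1 : alpha != 1.
Hypothesis beta_irrational : forall p q : int, q != 0 -> p%:~R + q%:~R * beta != 0.

Let gamma := exp (ln alpha * beta).

Section Determinant.
Variable n : nat.
Hypothesis n_gt0 : (0 < n)%N.

(* The index [l] stands for the pair [(u, t) = (l %/ n, l %% n)] with [u < n ^ 3] and
   [t < n], and [m] for the pair [(m %/ n ^ 2, m %% n ^ 2)]. *)
Let node (m : nat) := (m %/ n ^ 2)%:R + (m %% n ^ 2)%:R * beta.
Let fn (l : 'I_(n ^ 4)) : nat -> R -> R := exp_poly ((l %% n)%:R * ln alpha) 'X^(l %/ n).

Let M : 'M[R]_(n ^ 4) := \matrix_(m, l) fn l 0%N (node m).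

Lemma div_lt_cube (l : 'I_(n ^ 4)) : (l %/ n < n ^ 3)%N.
Proof. by rewrite ltn_divLR // -expnSr. Qed.

Lemma node_inj : injective (fun m : 'I_(n ^ 4) => node m).
Proof.
move=> i j; rewrite /node => E.
have [ijm|ijm] := eqVneq (i %% n ^ 2)%N (j %% n ^ 2)%N.
  move: E; rewrite ijm => /addIr/eqP; rewrite eqr_nat => /eqP ijd.
  by apply: val_inj; rewrite /= (divn_eq i (n ^ 2)) (divn_eq j (n ^ 2)) ijm ijd.
have : ((i %/ n ^ 2)%:Z - (j %/ n ^ 2)%:Z)%:~R +
    ((i %% n ^ 2)%:Z - (j %% n ^ 2)%:Z)%:~R * beta = 0 :> R.
  rewrite !rmorphB /= -!pmulrn.
  transitivity (((i %/ n ^ 2)%:R + (i %% n ^ 2)%:R * beta) -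
    ((j %/ n ^ 2)%:R + (j %% n ^ 2)%:R * beta)); first by ring.
  by rewrite E subrr.
move/eqP; rewrite (negbTE (beta_irrational _ _)) //.
by rewrite subr_eq0 eqz_nat.
Qed.

Lemma node_bound (c : R) (m : 'I_(n ^ 4)) :
  1 + `|beta| <= c -> - (c * n%:R ^+ 2) <= node m <= c * n%:R ^+ 2.
Proof.
move=> hc; rewrite -ler_norml /node; apply: le_trans (ler_normD _ _) _.
rewrite normrM !normr_nat; apply: le_trans (ler_wpM2r (exprn_ge0 _ (ler0n _ _)) hc).
rewrite mulrDl mul1r -natrX; apply: lerD.
  by rewrite ler_nat ltnW // ltn_divLR ?expn_gt0 ?n_gt0 // -expnD.
rewrite mulrC; apply: ler_wpM2l => //.
by rewrite ler_nat ltnW // ltn_pmod // expn_gt0 n_gt0.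
Qed.

(** A nontrivial relation between the columns is an exponential polynomial with [n] exponents and
    degrees below [n ^ 3], zero at [n ^ 4] distinct nodes: too many for [exp_poly_zeros]. *)
Lemma det_neq0 : \det M != 0.
Proof.
apply/negP; rewrite -det_tr => /det0P[v v0 vM].
pose P t := \sum_(l < n ^ 4 | (l %% n)%N == t) v 0 l *: 'X^(l %/ n).
have Pz t : (t < n)%N -> P t = 0.
  pose c := 1 + `|beta|.
  apply: (@exp_poly_zeros (- (c * n%:R ^+ 2)) (c * n%:R ^+ 2) (n ^ 3) n
    (fun t => t%:R * ln alpha) P [seq node m | m : 'I_(n ^ 4)]).
  - move=> i j _ _ /mulIf => ij; apply/eqP; rewrite -(eqr_nat R); apply/eqP; apply: ij.
    apply/eqP => l0; case/eqP: alpha_neq1; apply: ln_inv.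
    + exact/RltP.
    + exact: Rlt_0_1.
    + by rewrite l0 ln_1.
  - move=> {}t; apply/leq_sizeP => j hj; rewrite /P coef_sum big1 // => l _.
    rewrite coefZ coefXn gtn_eqF ?mulr0 //.
    exact: leq_trans (div_lt_cube l) hj.
  - by rewrite map_inj_uniq ?enum_uniq //; exact: node_inj.
  - by rewrite size_map -cardE card_ord -expnSr.
  - by apply/allP => _ /mapP[m _ ->]; apply: node_bound.
  move=> _ /mapP[m _ ->].
  have := congr1 (fun u : 'rV[R]_(n ^ 4) => u 0 m) vM; rewrite !mxE => {2}<-.
  rewrite (partition_big (fun l : 'I_(n ^ 4) => Ordinal (ltn_pmod l n_gt0)) xpredT) //=.
  apply: eq_bigr => t0 _; rewrite /P horner_sum mulr_suml; apply: eq_big => l.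
    by rewrite -val_eqE.
  by move=> /eqP lt0; rewrite !mxE /fn /exp_poly /= lt0 hornerZ mulrA.
case/eqP: v0; apply/rowP => l; rewrite mxE.
have /polyP/(_ (l %/ n)%N) := Pz (l %% n)%N (ltn_pmod l n_gt0).
rewrite coef0 /P coef_sum (bigD1 l) //= coefZ coefXn eqxx mulr1 big1 ?addr0 //.
move=> j /andP[/eqP jm jl]; rewrite coefZ coefXn; case: eqP => [jd|_]; last by rewrite mulr0.
by case/eqP: jl; apply: val_inj; rewrite /= (divn_eq j n) (divn_eq l n) jm jd.
Qed.

(** [X = c n^2] bounds the nodes. In the monomial bound [v = n] is allowed because [n ^ 3 <= n X];
    then [|w| + v <= n W], and [exp (|w| X)] is at most [G ^ (n ^ 3)]. *)
Lemma det_upper_bound (c G W : nat) :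
  1 + `|beta| <= c%:R -> `|ln alpha| + 1 <= W%:R -> exp (`|ln alpha| * c%:R) <= G%:R ->
  `|\det M| * (\prod_(i < n ^ 4) i`!)%N%:R <=
  ((\prod_(i < n ^ 4) (2 * (c * n ^ 2)) ^ i) *
   (\prod_(i < n ^ 4) ((c * n ^ 2 * G) ^ (n ^ 3) * (n * W) ^ i)) * (n ^ 4)`!)%N%:R.
Proof.
move=> hc hW hG; pose X : R := (c * n ^ 2)%N%:R.
have XE : X = c%:R * n%:R ^+ 2 by rewrite /X natrM natrX.
have c0 : (0 < c)%N by rewrite -(ltr_nat R); apply: lt_le_trans hc; have := normr_ge0 beta; lra.
pose E : R := ((c * n ^ 2 * G) ^ (n ^ 3))%N%:R; pose Y : R := (n * W)%N%:R.
rewrite !natrM !natr_prod mulr_natr.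
have -> : \prod_(i < n ^ 4) ((2 * (c * n ^ 2)) ^ i)%:R = \prod_(i < n ^ 4) (2 * X) ^+ i :> R.
  by apply: eq_bigr => i _; rewrite natrX natrM.
have -> : \prod_(i < n ^ 4) ((c * n ^ 2 * G) ^ (n ^ 3) * (n * W) ^ i)%:R =
    \prod_(i < n ^ 4) (E * Y ^+ i) :> R.
  by apply: eq_bigr => i _; rewrite natrM (natrX _ _ i).
apply: (@interpolation_det_bound _ X fn (fun m => node m)).
- by move=> l; apply: exp_poly_derivative.
- exact: node_inj.
- by move=> m; rewrite XE; apply: node_bound.
move=> l i t tX; rewrite /fn; set lw := _ * ln alpha.
have lwn : `|lw| <= n%:R * `|ln alpha|.
  rewrite /lw normrM normr_nat; apply: ler_wpM2r => //.
  by rewrite ler_nat ltnW // ltn_pmod.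
apply: le_trans (@exp_poly_monomial_bound (n ^ 3) X n%:R lw (l %/ n) i t _ _ _ _ tX) _ => //.
- by rewrite /X -[1]/(1%:R) ler_nat muln_gt0 c0 expn_gt0 n_gt0.
- by rewrite /X -natrM ler_nat mulnCA -expnS leq_pmull.
- exact: ltnW (div_lt_cube l).
have n0 : 0 <= n%:R :> R by exact: ler0n.
apply: ler_pM.
- by rewrite mulr_ge0 ?exprn_ge0 ?(ltW (exp_gt0 _)) // /X ler0n.
- by rewrite exprn_ge0 // addr_ge0.
- rewrite /E natrX natrM exprMn; apply: ler_wpM2l; first by rewrite exprn_ge0 ?ler0n.
  apply: le_trans (_ : exp (`|ln alpha| * c%:R) ^+ (n ^ 3) <= _); last first.
    by rewrite lerXn2r ?nnegrE ?(ltW (exp_gt0 _)) ?ler0n.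
  rewrite expRX; apply: exp_homo; rewrite -[_ *+ (n ^ 3)]mulr_natr expnS natrM.
  rewrite natrX XE; apply: le_trans (ler_wpM2r _ lwn) _; last by lra.
  by rewrite -XE ler0n.
- rewrite lerXn2r ?nnegrE ?addr_ge0 ?ler0n // /Y natrM.
  apply: le_trans (ler_wpM2l n0 hW); rewrite mulrDr mulr1; lra.
Qed.

(** An entry is a product of at most [3 n^3] factors among [node m], [alpha] and [gamma]. Scaled by
    [D ^ (3 n^3)], the entries act on [w], hence so does the determinant, and [acts_lower_bound]
    applies. *)
Lemma acts_det_lower_bound (J : finType) (w : J -> R) (D : int) (h : R) (j : J) (K : nat) :
  w j != 0 -> D != 0 -> `|D%:~R : R| <= K%:R -> h <= K%:R ->
  acts w (D%:~R * alpha) h -> acts w (D%:~R * beta) h -> acts w (D%:~R * gamma) h ->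
  1 <= `|\det M| * ((K ^ (3 * n ^ 3)) ^ n ^ 4 *
    (1 + ((2 * n ^ 2 * K) ^ (3 * n ^ 3)) ^ n ^ 4 * (n ^ 4)`!) ^ #|J| * #|J|`!)%N%:R.
Proof.
move=> wj D0 DK hK Aa Ab Ac.
have K0 : 0 <= K%:R :> R by exact: ler0n.
pose Q : R := (2 * n ^ 2 * K)%N%:R.
have Q0 : 0 <= Q by exact: ler0n.
have KQ : K%:R <= Q by rewrite /Q ler_nat leq_pmull // muln_gt0 /= expn_gt0 n_gt0.
have AD : acts w D%:~R Q by apply: acts_weaken (acts_int w D); apply: le_trans DK KQ.
have Aa' : acts w (D%:~R * alpha) Q by apply: acts_weaken Aa; apply: le_trans hK KQ.
have Ac' : acts w (D%:~R * gamma) Q by apply: acts_weaken Ac; apply: le_trans hK KQ.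
have Ax (m : 'I_(n ^ 4)) : acts w (D%:~R * node m) Q.
  have -> : D%:~R * node m = (m %/ n ^ 2)%N%:~R * D%:~R + (m %% n ^ 2)%N%:~R * (D%:~R * beta).
    by rewrite /node -!pmulrn; ring.
  have nn (a : nat) : (a <= n ^ 2)%N -> `|a%:~R : R| <= (n ^ 2)%:R.
    by move=> an; rewrite -pmulrn normr_nat ler_nat.
  apply: (@acts_weaken _ _ _ _ ((n ^ 2)%:R * K%:R + (n ^ 2)%:R * K%:R)).
    by rewrite /Q -!natrM -natrD ler_nat -mulnA mul2n addnn.
  have n20 : (0 < n ^ 2)%N by rewrite expn_gt0 n_gt0.
  apply: actsD; apply: actsM => //; try exact: acts_weaken (acts_int _ _).
  - apply: acts_weaken (acts_int _ _); apply: nn.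
    by rewrite ltnW // ltn_divLR // -expnD.
  - apply: acts_weaken (acts_int _ _); apply: nn.
    by rewrite ltnW // ltn_pmod.
  - exact: acts_weaken Ab.
have entry (m l : 'I_(n ^ 4)) : acts w (D%:~R ^+ (3 * n ^ 3) * M m l) (Q ^+ (3 * n ^ 3)).
  rewrite mxE /fn /exp_poly /= hornerXn.
  set u := (l %/ n)%N; set t := (l %% n)%N.
  set a := (m %/ n ^ 2)%N; set b := (m %% n ^ 2)%N.
  have tn : (t <= n)%N by rewrite ltnW // ltn_pmod.
  have un : (u <= n ^ 3)%N by exact: ltnW (div_lt_cube l).
  have n20 : (0 < n ^ 2)%N by rewrite expn_gt0 n_gt0.
  have ta : (t * a <= n ^ 3)%N.
    by rewrite expnS leq_mul // ltnW // /a ltn_divLR // -expnD.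
  have tb : (t * b <= n ^ 3)%N by rewrite expnS leq_mul // ltnW // ltn_pmod.
  have -> : exp (t%:R * ln alpha * node m) = alpha ^+ (t * a) * gamma ^+ (t * b).
    rewrite /gamma -{2}(exp_ln alpha); last exact/RltP.
    rewrite !expRX -exp_add; congr (exp _); rewrite /node -/a -/b.
    rewrite -[_ *+ (t * a)]mulr_natr -[_ *+ (t * b)]mulr_natr !natrM; ring.
  (* The exponents may add up to less than [3 * n ^ 3]; the remaining [r] factors [D] act as
     integers. *)
  pose r := (3 * n ^ 3 - (u + t * a + t * b))%N.
  have rE : (3 * n ^ 3 = u + t * a + t * b + r)%N by rewrite /r subnKC // !mulSn mul0n addn0 addnA !leq_add.
  rewrite rE.
  have -> : D%:~R ^+ (u + t * a + t * b + r) * (node m ^+ u * (alpha ^+ (t * a) * gamma ^+ (t * b)))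
    = (D%:~R * node m) ^+ u * (D%:~R * alpha) ^+ (t * a) * (D%:~R * gamma) ^+ (t * b) * D%:~R ^+ r.
    rewrite !exprMn !exprD; ring.
  rewrite !exprD.
  by do 3 (apply: actsM; [exact: exprn_ge0| |exact: actsX]); exact: actsX.
have Adet := acts_det (exprn_ge0 _ Q0) (A := D%:~R ^+ (3 * n ^ 3) *: M) _.
have {}Adet : acts w (\det (D%:~R ^+ (3 * n ^ 3) *: M))
    ((Q ^+ (3 * n ^ 3)) ^+ (n ^ 4) *+ (n ^ 4)`!).
  by apply: Adet => i k; rewrite mxE; apply: entry.
have := acts_lower_bound _ wj _ Adet.
have h0 : 0 <= (Q ^+ (3 * n ^ 3)) ^+ (n ^ 4) *+ (n ^ 4)`!.
  by rewrite mulrn_wge0 // !exprn_ge0.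
rewrite detZ mulf_neq0 ?expf_neq0 ?intr_eq0 ?det_neq0 // => /(_ h0 isT).
move=> H; apply: le_trans H _.
rewrite normrM [`|_ ^+ _| * _]mulrC -mulrA; apply: ler_wpM2l => //.
rewrite -[_ *+ #|J|`!]mulr_natr mulrA !natrM; apply: ler_wpM2r; first exact: ler0n.
apply: ler_pM => //; first by rewrite exprn_ge0 // addr_ge0.
  by rewrite !normrX !natrX !lerXn2r ?nnegrE ?exprn_ge0.
by rewrite (natrX _ _ #|J|) natrD natrM mulr_natr !(natrX _ (_ ^ _)) (natrX _ (2 * _ * _)).
Qed.
End Determinant.
End GelfondSchneider.

(** With all real constants rounded up to naturals, the two bounds for the determinant contradict
    each other for the [n] of [gelfond_schneider_parameters]. *)
Lemma gelfond_schneider_core (p1 p2 p3 : {poly int}) (alpha beta : R) :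
  0 < alpha -> alpha != 1 ->
  p1 != 0 -> root (map_poly intr p1) alpha ->
  p2 != 0 -> root (map_poly intr p2) beta ->
  p3 != 0 -> root (map_poly intr p3) (exp (ln alpha * beta)) ->
  exists p q : int, q != 0 /\ p%:~R + q%:~R * beta = 0.
Proof.
move=> a0 a1 p10 r1 p20 r2 p30 r3.
have [J [w [D [h [[j wj] D0 Aa Ab Ac]]]]] := acts_triple p10 p20 p30 r1 r2 r3.
apply: Classical_Prop.NNPP => irr.
have {}irr p q : q != 0 -> p%:~R + q%:~R * beta != 0.
  by move=> q0; apply/eqP => pq; apply: irr; exists p, q.
have ub (x : R) : exists2 k : nat, (0 < k)%N & x <= k%:R.
  exists (Num.bound `|x|).+1 => //; apply: le_trans (ler_norm x) _.
  have xb := archi_boundP (normr_ge0 x).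
  by apply: le_trans (ltW xb) _; rewrite ler_nat leqnSn.
have [c c0 hc] := ub (1 + `|beta|).
have [W W0 hW] := ub (`|ln alpha| + 1).
have [G G0 hG] := ub (exp (`|ln alpha| * c%:R)).
have [K K0 hK] := ub (`|D%:~R| + `|h|).
have DK : `|D%:~R : R| <= K%:R by apply: le_trans hK; rewrite lerDl.
have hK' : h <= K%:R.
  by apply: le_trans (ler_norm h) (le_trans _ hK); rewrite lerDr.
have [n n0 hn] := gelfond_schneider_parameters G K #|J| c0 W0.
have U := det_upper_bound irr n0 hc hW hG.
have L := acts_det_lower_bound a0 a1 irr n0 wj D0 DK hK' Aa Ab Ac.
move: U L; set d := `|_|; set P := (\prod_(i < n ^ 4) i`!)%N in hn *; set Z := (_ * (n ^ 4)`!)%N in hn *.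
set Y := (_ * #|J|`!)%N in hn * => U L.
have : (P%:R : R) <= (Z * Y)%N%:R.
  rewrite natrM; apply: le_trans (ler_wpM2r (ler0n _ Y) U).
  by rewrite mulrAC; apply: ler_peMl => //; exact: ler0n.
by rewrite ler_nat leqNgt hn.
Qed.

(** * Rational solutions *)

Section RationalPowers.

(** Bezout's [1 + e a = c d] gives [p * (x ^ a) ^ d = (p ^ c) ^ d], so [p] is a quotient of [d]-th
    powers, and [x ^ a] divides [p ^ c]. *)
Lemma coprime_exp_root (p x d e : nat) :
  (0 < p)%N -> (0 < d)%N -> coprime d e -> (x ^ d = p ^ e)%N -> exists r, p = (r ^ d)%N.
Proof.
move=> p0 d0 /eqP de xp; have x0 : (0 < x)%N.
  by rewrite lt0n; apply: contra_eqN xp => /eqP ->; rewrite exp0n // eq_sym -lt0n expn_gt0 p0.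
have [a _] := Bezoutl e d0; rewrite de => /dvdnP[c cE].
have E : (p * (x ^ a) ^ d = (p ^ c) ^ d)%N.
  by rewrite -expnM mulnC [(a * d)%N]mulnC expnM xp -expnM -expnSr -expnM -cE add1n [(e * a)%N]mulnC.
have dv : (x ^ a %| p ^ c)%N by rewrite -(dvdn_pexp2r _ _ d0) -E dvdn_mull.
exists (p ^ c %/ x ^ a)%N; rewrite -{1}(divnK dv) expnMn in E.
by apply/eqP; rewrite -(eqn_pmul2r (m := (x ^ a) ^ d)) ?E // !expn_gt0 x0.
Qed.

(** For [d >= 2] and [x >= 1], induction on [d] gives [(x + 1) ^ d > x ^ d + d]. *)
Lemma close_powers (x y d : nat) :
  (0 < x)%N -> (0 < d)%N -> (x ^ d < y ^ d)%N -> (y ^ d <= x ^ d + d)%N -> d = 1%N.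
Proof.
move=> x0 d0 xy yd; case: d d0 xy yd => [//|[//|d]] _ xy yd; exfalso.
have {}xy : (x.+1 <= y)%N by rewrite -(ltn_exp2r _ _ (ltn0Sn d.+1)).
have : (x.+1 ^ d.+2 <= y ^ d.+2)%N by rewrite leq_exp2r.
move=> /leq_trans/(_ yd); apply/negP; rewrite -ltnNge.
elim: d {yd} => [|d IH]; first by rewrite /= !expnS !expn0; nia.
rewrite (expnS x) (expnS x.+1).
apply: leq_ltn_trans (_ : x * (x ^ d.+2 + d.+2) + (x ^ d.+2 + d.+2) < _)%N.
  have : (0 < x ^ d.+2)%N by rewrite expn_gt0 x0.
  nia.
by rewrite addnC -mulSn ltn_pmul2l.
Qed.

Lemma rational_posP (x : R) : is_rational x -> 0 < x ->
  exists p q : nat, [/\ (0 < p)%N, (0 < q)%N, coprime p q & x = p%:R / q%:R].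
Proof.
move=> [p [q [q0 xE]]] x0.
have {xE} xE : x = (Z.abs_nat p)%:R / (Z.abs_nat q)%:R.
  rewrite -[x]gtr0_norm // xE RdivE normrM normfV -!INRE !INR_IZR_INZ !Zabs2Nat.id_abs.
  by rewrite -!RabsE !Rabs_Zabs.
move: (Z.abs_nat p) (Z.abs_nat q) xE => m n xE.
have n0 : (0 < n)%N by rewrite lt0n; apply: contraTneq x0 => nE; rewrite xE nE invr0 mulr0 ltxx.
have m0 : (0 < m)%N by rewrite lt0n; apply: contraTneq x0 => mE; rewrite xE mE mul0r ltxx.
have g0 : (0 < gcdn m n)%N by rewrite gcdn_gt0 m0.
exists (m %/ gcdn m n)%N, (n %/ gcdn m n)%N; split.
- by rewrite divn_gt0 // dvdn_leq // dvdn_gcdl.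
- by rewrite divn_gt0 // dvdn_leq // dvdn_gcdr.
- rewrite /coprime -(eqn_pmul2r g0) muln_gcdl !divnK ?dvdn_gcdl ?dvdn_gcdr //.
  by rewrite mul1n.
- have := divnK (dvdn_gcdr m n); have := divnK (dvdn_gcdl m n).
  rewrite xE; set g := gcdn m n in g0 *; move=> {1}<- {1}<-; rewrite !natrM invfM.
  by rewrite mulrACA divff ?mulr1 // pnatr_eq0 -lt0n.
Qed.

Lemma rational_div (p q : nat) : (0 < q)%N -> is_rational (p%:R / q%:R).
Proof.
move=> q0; exists (Z.of_nat p), (Z.of_nat q); split; first by move: q0; lia.
by rewrite -!INR_IZR_INZ RdivE !INRE.
Qed.

(** For [s = x / y] in lowest terms, [x ^ d = p ^ e] and [y ^ d = q ^ e]; so [p] and [q] are [d]-th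
    powers at distance at most [d]. This serves both to find the shape of [A] and to compute its
    order. *)
Lemma rational_root_rigid (s : R) (p q d e : nat) :
  is_rational s -> 0 < s -> (0 < p)%N -> (p < q)%N -> coprime p q -> (0 < d)%N ->
  coprime d e -> s ^+ d = (p%:R / q%:R) ^+ e -> (q <= p + d)%N -> d = 1%N.
Proof.
move=> rs s0 p0 pq cpq d0 de E qd.
have [x [y [x0 y0 cxy sE]]] := rational_posP rs s0.
have q0 : (0 < q)%N by apply: leq_trans pq.
have {}E : (x ^ d * q ^ e = p ^ e * y ^ d)%N.
  apply/eqP; rewrite -(eqr_nat R) !natrM !natrX -eqr_div ?expf_neq0 ?pnatr_eq0 -?lt0n //.
  by rewrite -!expr_div_n -sE E.
have xp : (x ^ d = p ^ e)%N.
  apply/eqP; rewrite eqn_dvd; apply/andP; split.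
    rewrite -(@Gauss_dvdl _ _ (y ^ d)) ?coprimeXl ?coprimeXr // -E dvdn_mulr //.
  rewrite -(@Gauss_dvdl _ _ (q ^ e)) ?coprimeXl ?coprimeXr // E dvdn_mulr //.
have yq : (y ^ d = q ^ e)%N.
  apply/eqP; rewrite -(eqn_pmul2l (m := p ^ e)) ?expn_gt0 ?p0 //.
  by rewrite -E xp.
have [u pu] := coprime_exp_root p0 d0 de xp.
have [w qw] := coprime_exp_root q0 d0 de yq.
apply: (@close_powers u w) => //; rewrite -?pu -?qw //.
by move: p0; rewrite pu expn_gt0 => /orP[//|]; rewrite eqn0Ngt d0.
Qed.
End RationalPowers.

(** * The numbers [special v] and their orders *)

Section SpecialValues.

(* The solution [A] of [A ^ a = b] and [A ^ b = a] for [a = r ^ v.+1], [b = r ^ v], [r = v / v.+1]. *)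
Definition special (v : nat) :=
  exp ((v.+1 ^ v.+1)%N%:R / (v ^ v)%N%:R * ln (v%:R / v.+1%:R)).

Lemma exp_lnX (x : R) n : 0 < x -> exp (n%:R * ln x) = x ^+ n.
Proof. by move=> x0; rewrite -{2}(exp_ln x); [rewrite expRX mulr_natl | exact/RltP]. Qed.

Variable v : nat.
Hypothesis v_gt0 : (0 < v)%N.

Let rho : R := v%:R / v.+1%:R.
Let c : R := (v.+1 ^ v.+1)%N%:R / (v ^ v)%N%:R.

Let rho_gt0 : 0 < rho. Proof. by rewrite divr_gt0 ?ltr0n. Qed.
Let ln_rho_lt0 : ln rho < 0.
Proof.
apply/RltP; rewrite -R0E -ln_1; apply: ln_increasing; apply/RltP; first exact: rho_gt0.
by rewrite ltr_pdivrMr ?ltr0n // mul1r ltr_nat.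
Qed.
Let vv_neq0 : (v ^ v)%N%:R != 0 :> R.
Proof. by rewrite pnatr_eq0 -lt0n expn_gt0 v_gt0. Qed.

Lemma ln_special : ln (special v) = c * ln rho.
Proof. exact: ln_exp. Qed.

Lemma special_lt1 : special v < 1.
Proof.
apply/RltP; rewrite -R1E -exp_0; apply: exp_increasing; apply/RltP.
rewrite pmulr_rlt0 ?ln_rho_lt0 // divr_gt0 // ltr0n expn_gt0 ?v_gt0 //.
Qed.

(** Multiplied by [ln rho], these identities are the logarithms of the two equations of
    [power_special]. *)
Lemma scaled_exponent : rho ^+ v.+1 * c = v%:R /\ rho ^+ v * c = v.+1%:R.
Proof.
have v0 : v%:R != 0 :> R by rewrite pnatr_eq0 -lt0n.
have v1 : v.+1%:R != 0 :> R by rewrite pnatr_eq0.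
rewrite /rho /c !natrX !expr_div_n; split.
  by rewrite mulrA divfK ?expf_neq0 // exprS mulfK ?expf_neq0.
by rewrite mulrACA [v.+1%:R ^+ v.+1]exprS; field; rewrite !expf_neq0.
Qed.

Lemma power_special :
  Rpower (special v) (rho ^+ v.+1) = rho ^+ v /\ Rpower (special v) (rho ^+ v) = rho ^+ v.+1.
Proof.
have [e1 e2] := scaled_exponent.
by split; rewrite -[RHS]exp_lnX // -?e1 -?e2 -mulrA -ln_special.
Qed.

Lemma special_expn : special v ^+ (v ^ v) = rho ^+ (v.+1 ^ v.+1).
Proof.
rewrite -(exp_lnX _ rho_gt0) /special expRX -[_ *+ (v ^ v)]mulr_natl -/rho; congr (exp _).
by rewrite mulrA mulrCA divff // mulr1.
Qed.

(** [special v ^ n] is [rho] to the power [E n / D]. In lowest terms this exponent has denominator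
    [1] by [rational_root_rigid], as numerator and denominator of [rho] differ by [1]. So [D]
    divides [E n], and [D] is coprime to [E]. *)
Lemma special_expn_rational n : is_rational (special v ^+ n) -> (v ^ v %| n)%N.
Proof.
case: (posnP n) => [->|n0 rs]; first by rewrite dvdn0.
set D := (v ^ v)%N; set E := (v.+1 ^ v.+1)%N.
have D0 : (0 < D)%N by rewrite expn_gt0 v_gt0.
pose g := gcdn D (E * n); have g0 : (0 < g)%N by rewrite gcdn_gt0 D0.
have gD : (D %/ g * g = D)%N by rewrite divnK ?dvdn_gcdl.
have gE : (E * n %/ g * g = E * n)%N by rewrite divnK ?dvdn_gcdr.
have s0 : 0 < special v by exact: exp_gt0.
have sE : (special v ^+ n) ^+ (D %/ g) = rho ^+ (E * n %/ g).
  apply: (pexpIrn g0); rewrite ?nnegrE ?exprn_ge0 ?(ltW s0) ?(ltW rho_gt0) //.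
  by rewrite -!exprM gE -mulnA gD mulnC exprM special_expn exprM.
have cop : coprime (D %/ g) (E * n %/ g).
  by rewrite /coprime -(eqn_pmul2r g0) muln_gcdl gD gE mul1n.
have Dg0 : (0 < D %/ g)%N by rewrite divn_gt0 // dvdn_leq // dvdn_gcdl.
have Dg : (D %/ g = 1)%N.
  apply: (rational_root_rigid rs _ v_gt0 (ltnSn v) (coprimenS v) Dg0 cop sE _).
    exact: exprn_gt0.
  by rewrite -[v.+1]addn1 leq_add2l Dg0.
have DEn : (D %| E * n)%N by rewrite -gD Dg mul1n dvdn_gcdr.
by rewrite -(@Gauss_dvdr _ E) // coprimeXl // coprimeXr // coprimenS.
Qed.
End SpecialValues.

Lemma conjugate_rational_exponents_lt (A a b : R) :
  0 < A -> 0 < a -> a < b -> is_rational a -> is_rational b ->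
  Rpower A a = b -> Rpower A b = a -> exists2 v, (0 < v)%N & A = special v.
Proof.
move=> A0 a0 ab ra rb Aa Ab.
have b0 : 0 < b by exact: lt_trans ab.
have lnb : ln b = a * ln A by rewrite -Aa; apply: ln_exp.
have lna : ln a = b * ln A by rewrite -{1}Ab; apply: ln_exp.
have [p [q [p0 q0 cpq abE]]] : exists p q : nat,
    [/\ (0 < p)%N, (0 < q)%N, coprime p q & a / b = p%:R / q%:R].
  apply: rational_posP; last exact: divr_gt0.
  have [x [y [x0 y0 _ ->]]] := rational_posP ra a0.
  have [z [t [z0 t0 _ ->]]] := rational_posP rb b0.
  by rewrite invf_div mulf_div -!natrM; apply: rational_div; rewrite muln_gt0 y0.
have pR : p%:R != 0 :> R by rewrite pnatr_eq0 -lt0n.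
have qR : q%:R != 0 :> R by rewrite pnatr_eq0 -lt0n.
have bn : b != 0 by rewrite gt_eqF.
have abE' : q%:R * a = p%:R * b.
  by move/eqP: abE; rewrite eqr_div // => /eqP <-; rewrite mulrC.
have pq : (p < q)%N.
  by rewrite -(ltr_nat R) -(ltr_pM2r b0) -abE' ltr_pM2l ?ltr0n.
have r0 : 0 < p%:R / q%:R :> R by rewrite divr_gt0 ?ltr0n.
have lnr : ln (p%:R / q%:R) = ln a - ln b by
  rewrite -abE ln_mult ?ln_Rinv //; apply/RltP; rewrite ?invr_gt0.
(* Both [q ln b] and [p ln a] equal [q a ln A]; subtracting [p ln b] gives the logarithm of the
   equation. *)
have bE : b ^+ (q - p) = (p%:R / q%:R) ^+ p.
  rewrite -!exp_lnX // natrB ?(ltnW pq) // lnr; congr (exp _).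
  have : q%:R * ln b = p%:R * ln a by rewrite lnb lna !mulrA abE'.
  by move=> h; rewrite mulrBl h mulrBr.
have d1 : (q - p = 1)%N.
  apply: (rational_root_rigid rb b0 p0 pq cpq _ _ bE _).
  - by rewrite subn_gt0.
  - by move: cpq; rewrite /coprime -{1}(subnKC (ltnW pq)) gcdnDl gcdnC.
  - by rewrite subnKC // ltnW.
have qE : q = p.+1 by rewrite -(subnK (ltnW pq)) d1 add1n.
subst q; exists p => //.
have {bE} bE : b = (p%:R / p.+1%:R) ^+ p by rewrite -bE d1 expr1.
have aE : a = (p%:R / p.+1%:R) ^+ p.+1.
  by rewrite exprS -bE -abE divfK.
have [e1 _] := scaled_exponent p0.
rewrite -(exp_ln A); last exact/RltP.
congr (exp _); apply: (mulfI (x := a)); first by rewrite gt_eqF.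
rewrite -lnb mulrA {1}aE e1 bE -exp_lnX //; exact: ln_exp.
Qed.

Lemma conjugate_rational_exponents (A a b : R) :
  0 < A -> 0 < a -> 0 < b -> a <> b -> is_rational a -> is_rational b ->
  Rpower A a = b -> Rpower A b = a -> exists2 v, (0 < v)%N & A = special v.
Proof.
move=> A0 a0 b0 /eqP; rewrite neq_lt => /orP[ab|ba] ra rb Aa Ab.
  exact: (conjugate_rational_exponents_lt A0 a0 ab).
exact: (conjugate_rational_exponents_lt A0 b0 ba).
Qed.

(** * Algebraic numbers as roots of integer polynomials *)

Section Algebraic.

Definition int_of_stdlib_Z (z : Z) : int :=
  match z with
  | Z0 => 0
  | Zpos p => (Pos.to_nat p)%:Z
  | Zneg p => - (Pos.to_nat p)%:Z
  end.

Lemma int_of_stdlib_Z_eq0 z : int_of_stdlib_Z z = 0 -> z = Z0.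
Proof. by case: z => //= p; have := Pos2Nat.is_pos p; lia. Qed.

Lemma IZR_int z : IZR z = (int_of_stdlib_Z z)%:~R.
Proof.
case: z => [|p|p] //=; first by rewrite -positive_nat_Z -INR_IZR_INZ INRE.
by rewrite rmorphN /= -pmulrn -INRE INR_IZR_INZ positive_nat_Z.
Qed.

Lemma horner_zpoly (l : list Z) (x : R) :
  (map_poly intr (Poly [seq int_of_stdlib_Z z | z <- l])).[x] = zpoly_eval l x.
Proof.
elim: l => [|z l IH] /=; first by rewrite rmorph0 horner0.
by rewrite cons_poly_def rmorphD rmorphM /= map_polyX map_polyC !hornerE IH IZR_int addrC mulrC.
Qed.

Lemma algebraic_root (x : R) : algebraic x ->
  exists2 p : {poly int}, p != 0 & root (map_poly intr p) x.
Proof.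
move=> [l [[c [cl c0]] lx]]; exists (Poly [seq int_of_stdlib_Z z | z <- l]); last first.
  by apply/eqP; rewrite horner_zpoly lx.
apply/eqP => l0; apply: c0; apply: int_of_stdlib_Z_eq0.
elim: l cl l0 {lx} => //= z l IH zl /polyP E.
case: zl => [<-|cl]; first by have := E 0%N; rewrite coef_cons coef0.
by apply: IH => //; apply/polyP => i; have := E i.+1; rewrite coef_cons !coef0.
Qed.

Lemma algebraic_of_rational_power (x : R) n :
  (0 < n)%N -> is_rational (x ^+ n) -> algebraic x.
Proof.
case: n => // n _ [p [q [q0 xE]]].
exists (Z.opp p :: List.app (List.repeat Z0 n) [:: q]); split.
  by exists q; split => //=; right; apply: List.in_or_app; right; left.
have ev : forall m, zpoly_eval (List.app (List.repeat Z0 m) [:: q]) x = x ^+ m * IZR q.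
  elim=> [|m IH] /=; first by rewrite !RealsE mulr0 addr0 expr0 mul1r.
  by rewrite IH !RealsE add0r exprS mulrA.
rewrite /= ev opp_IZR !RealsE mulrA -exprS xE RdivE divfK ?addNr //.
by apply/eqP; apply: not_0_IZR.
Qed.

Lemma algebraic_of_rational (x : R) : is_rational x -> algebraic x.
Proof. by move=> rx; apply: (@algebraic_of_rational_power x 1); rewrite ?expr1. Qed.

Theorem gelfond_schneider (alpha beta : R) :
  0 < alpha -> alpha <> 1 -> algebraic alpha -> algebraic beta ->
  algebraic (Rpower alpha beta) -> is_rational beta.
Proof.
move=> a0 /eqP a1 /algebraic_root[p1 p10 r1] /algebraic_root[p2 p20 r2].
move=> /algebraic_root[p3 p30]; rewrite /Rpower RmultE mulrC => r3.
have [p [q [q0 pq]]] := gelfond_schneider_core a0 a1 p10 r1 p20 r2 p30 r3.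
have qR : q%:~R != 0 :> R by rewrite intr_eq0.
have intE (m : int) : exists z, m%:~R = IZR z.
  case: m => m; first by exists (Z.of_nat m); rewrite -INR_IZR_INZ INRE.
  exists (Z.opp (Z.of_nat m.+1)); by rewrite opp_IZR -INR_IZR_INZ INRE NegzE rmorphN.
have [zp zpE] := intE (- p); have [zq zqE] := intE q.
exists zp, zq; split.
  by move=> z0; move: qR; rewrite zqE z0 eqxx.
by rewrite RdivE -zpE -zqE rmorphN /= (addr0_eq pq) mulrC mulKf.
Qed.
End Algebraic.

(** * The numbers with algebraic tower limits *)

Section Counted.

Lemma Nat_powE m n : Nat.pow m n = (m ^ n)%N.
Proof. by elim: n => //= n ->; rewrite expnS. Qed.

Lemma special_ord v : (0 < v)%N -> ord_eq (special v) (v ^ v).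
Proof.
move=> v0; have vv0 : (0 < v ^ v)%N by rewrite expn_gt0 v0.
split; first exact/ssrnat.leP.
split; first by rewrite RpowE special_expn // expr_div_n -!natrX; apply: rational_div; rewrite expn_gt0.
move=> n /ssrnat.leP n0 /ssrnat.ltP nv; rewrite RpowE => /(special_expn_rational v0) /(dvdn_leq n0).
by rewrite leqNgt nv.
Qed.

Lemma ord_eq_uniq (A : R) m n : ord_eq A m -> ord_eq A n -> m = n.
Proof.
move=> [m1 [rm hm]] [n1 [rn hn]]; case: (ltngtP m n) => [/ssrnat.ltP mn|/ssrnat.ltP nm|//].
  by case: (hn m m1 mn).
by case: (hm n n1 nm).
Qed.

Lemma counted_special v : (0 < v)%N -> counted (v ^ v) (special v).
Proof.
move=> v0; have [e1 e2] := power_special v0.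
set r := v%:R / v.+1%:R in e1 e2.
have r0 : 0 < r by rewrite divr_gt0 ?ltr0n.
have r1 : r < 1 by rewrite ltr_pdivrMr ?ltr0n // mul1r ltr_nat.
have rrat n : is_rational (r ^+ n).
  by rewrite /r expr_div_n -!natrX; apply: rational_div; rewrite expn_gt0.
have [] := @tower_limits (special v) _ _ (r ^+ v.+1) (r ^+ v) _ _ e1 e2.
- exact: exp_pos.
- exact/RltP/special_lt1.
- by apply/RltP; rewrite exprn_gt0.
- by apply/RltP; rewrite exprS gtr_pMl // exprn_gt0.
move=> lt_e [lo le]; have so := special_ord v0; split; last split; last split => //.
- by case: so => _ [so _]; apply: (@algebraic_of_rational_power _ (v ^ v)); rewrite ?expn_gt0 ?v0 -?RpowE.
- by split => //; apply: exp_pos.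
- exists (r ^+ v.+1), (r ^+ v); split; [exact: lo | split; [exact: le|]].
  by split; apply: algebraic_of_rational.
Qed.

(** [A] raised to either limit is the other limit, hence algebraic, so Gelfond-Schneider makes both
    limits rational. The order of [special v] then fixes [k]. *)
Lemma counted_is_special k (A : R) : counted k A ->
  exists v, [/\ (0 < v)%N, A = special v & k = (v ^ v)%N].
Proof.
move=> [algA [[A0 Ae] [[ho [he [lo [le [algo alge]]]]] ordA]]].
have A1 : Rlt A 1%R.
  apply: Rlt_trans Ae _; rewrite -R1E -exp_0; apply: exp_increasing.
  by apply/RltP; rewrite oppr_lt0 exp_gt0.
have [ho0 [he0 [neq [Eo Ee]]]] := tower_limits_inv A A0 A1 ho he Ae lo le.
have A1' : A <> 1 by apply: Rlt_not_eq.
move: A0 ho0 he0 => /RltP A0 /RltP ho0 /RltP he0.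
have ro : is_rational ho by apply: (gelfond_schneider A0 A1' algA algo); rewrite Eo.
have re : is_rational he by apply: (gelfond_schneider A0 A1' algA alge); rewrite Ee.
have [v v0 Av] := conjugate_rational_exponents A0 ho0 he0 neq ro re Eo Ee.
exists v; split => //; apply: ord_eq_uniq ordA _.
by rewrite Av; apply: special_ord.
Qed.

Lemma expnn_inj v w : (0 < v)%N -> (0 < w)%N -> (v ^ v = w ^ w)%N -> v = w.
Proof.
have lt a b : (0 < a)%N -> (a < b)%N -> (a ^ a < b ^ b)%N.
  move=> a0 ab; apply: leq_ltn_trans (leq_pexp2l a0 (ltnW ab)) _.
  by rewrite ltn_exp2r // (leq_ltn_trans _ ab).
move=> v0 w0 E; case: (ltngtP v w) => // h; [have := lt _ _ v0 h|have := lt _ _ w0 h];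
  by rewrite E ltnn.
Qed.

Lemma counted_unique k : (exists v : nat, k = Nat.pow v v) -> exists! A : R, counted k A.
Proof.
(* [Nat.pow 0 0 = 1], so [u = 0] yields the same [k] as [v = 1]. *)
move=> [u ->]; have [v v0 ->] : exists2 v, (0 < v)%N & Nat.pow u u = (v ^ v)%N.
  by case: u => [|u]; [exists 1%N | exists u.+1; rewrite ?Nat_powE].
exists (special v); split; first exact: counted_special.
by move=> A /counted_is_special[w [w0 -> /(expnn_inj v0 w0) ->]].
Qed.

Lemma counted_none k : ~ (exists v : nat, k = Nat.pow v v) -> forall A : R, ~ counted k A.
Proof. by move=> nk A /counted_is_special[v [_ _ kv]]; apply: nk; exists v; rewrite Nat_powE. Qed.
End Counted.

End TowerLimits.

Theorem theorem6p2 (k : nat) (hk : (1 <= k)%nat) :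
  ((exists v : nat, k = Nat.pow v v) -> exists! A : R, counted k A) /\
  (~ (exists v : nat, k = Nat.pow v v) -> forall A : R, ~ counted k A).
Proof.
  split.
  - apply TowerLimits.counted_unique.
  - apply TowerLimits.counted_none.
Qed.
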